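(* Let $A$ be a finite-dimensional unimodular ribbon Hopf algebra over a field $k$, and let $J:Z(A)\to Z(A)$ be defined as $J(z)=(\lambda\otimes1)\big((z\otimes1)R^{21}R\big)=\sum_{i,j}\lambda(z\beta_i\alpha_j)\alpha_i\beta_j$. Then: (a) $J:Z_\star(A)\to Z(A)$ is an algebra homomorphism, i.e. for any $a,b\in Z(A)$, $J(a\star b)=J(a)J(b)$; (b) for any $a\in Z(A)$, $J^2(a)=S(a)\star J(1)$; (c) $J$ factors through an algebra homomorphism $\hat J:\hat Z_\star(A)\to\hat Z(A)$, which maps $\hat Z^S(A)$ into itself.
   Context: $A=(A,m,\Delta,S,\epsilon,e)$ is a finite-dimensional Hopf algebra over a field $k$ (multiplication $m$, comultiplication $\Delta$, antipode $S$, counit $\epsilon$, unit $e$); Sweedler notation $\Delta(a)=\sum_a a_{(1)}\otimes a_{(2)}$. Quasitriangular: $A$ is endowed with an invertible element $R=\sum_i\alpha_i\otimes\beta_i\in A\otimes A$ such that $T\circ\Delta(a)=R\Delta(a)R^{-1}$ for all $a\in A$ (with $T$ the flip), $(\Delta\otimes1)R=R^{13}R^{23}$ and $(1\otimes\Delta)R=R^{13}R^{12}$; $R^{21}=\sum_i\beta_i\otimes\alpha_i$. Ribbon: $A$ is quasitriangular and endowed with a grouplike element $g\in A$ ($g$ is invertible and $\Delta(g)=g\otimes g$) such that $S^2(a)=gag^{-1}$ for all $a\in A$. Unimodular: the spaces of left and right integrals of $A$ coincide. $\Lambda\in A$ is an integral ($a\Lambda=\Lambda a=\epsilon(a)\Lambda$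 for all $a\in A$) and $\lambda\in A^*$ is a right integral for $A^*$ ($\sum_a\lambda(a_{(1)})a_{(2)}=\lambda(a)1$ for all $a\in A$), with $\lambda(\Lambda)=1$. $a\star b=\sum_b\lambda(S(a)b_{(1)})b_{(2)}$. $Z(A)$ is the center of $A$ with its usual product, and $Z_\star(A)$ is the algebra with underlying vector space $Z(A)$ and product $\star$ (with identity $\Lambda$). $K(A)=\{a\in Z(A)\mid\lambda(ab)=0\text{ for any }b\in Z(A)\}$; $\hat Z(A)=Z(A)/K(A)$ with the usual product, and $\hat Z_\star(A)$ is the same quotient space with the product induced by $\star$; $[a]$ is the class of $a\in Z(A)$ in the quotient; $\hat Z^S(A)=\{[a]\in\hat Z(A)\mid[S(a)]=[a]\}$. *)

(* Defs.v *)
From HB Require Import structures.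
From mathcomp Require Import all_boot all_order all_algebra all_field.

Set Implicit Arguments.
Unset Strict Implicit.
Unset Printing Implicit Defensive.

Import GRing.Theory Quotient.
Local Open Scope ring_scope.
Local Open Scope quotient_scope.

(* U (x) V is represented by matrices of coordinates with respect to the      *)
(* bases vbasis {:U} and vbasis {:V}; tmapE, tmap_unique and tens_bilinear    *)
(* below are its universal property.                                          *)
Definition tensor (k : fieldType) (U V : vectType k) : Type :=
  'M[k]_(\dim {:U}, \dim {:V}).

HB.instance Definition _ (k : fieldType) (U V : vectType k) :=
  Vector.on (tensor U V).

Definition bilin (k : fieldType) (U V W : lmodType k) (f : U -> V -> W) : Prop :=
  (forall v, linear (f^~ v)) /\ (forall u, linear (f u)).

Section TensorSpace.
Variables (k : fieldType) (U V : vectType k).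

Definition tens (u : U) (v : V) : tensor U V :=
  \matrix_(i, j) (coord (vbasis {:U}) i u * coord (vbasis {:V}) j v).

(* The linear map induced by f; only meaningful when f is bilinear.           *)
Definition tmap (W : lmodType k) (f : U -> V -> W) (t : tensor U V) : W :=
  \sum_i \sum_j t i j *: f (vbasis {:U})`_i (vbasis {:V})`_j.

Lemma tmap_is_linear (W : lmodType k) (f : U -> V -> W) : linear (tmap f).
Proof.
move=> a s t; rewrite /tmap scaler_sumr -big_split; apply: eq_bigr => i _ /=.
rewrite scaler_sumr -big_split; apply: eq_bigr => j _ /=.
by rewrite !mxE scalerDl scalerA.
Qed.
HB.instance Definition _ (W : lmodType k) (f : U -> V -> W) :=
  GRing.isLinear.Build k (tensor U V) W _ (tmap f) (@tmap_is_linear W f).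

Lemma tmap_lincomb (W : lmodType k) (f g h : U -> V -> W) c t :
  (forall u v, h u v = c *: f u v + g u v) ->
  tmap h t = c *: tmap f t + tmap g t.
Proof.
move=> hE; rewrite /tmap scaler_sumr -big_split; apply: eq_bigr => i _ /=.
rewrite scaler_sumr -big_split; apply: eq_bigr => j _ /=.
by rewrite hE scalerDr !scalerA mulrC.
Qed.

Lemma tens_bilinear : bilin tens.
Proof.
split=> [v a u u'|u a v v']; apply/matrixP=> i j; rewrite !mxE linearP /=.
  by rewrite mulrDl mulrA.
by rewrite mulrDr mulrCA.
Qed.

Lemma tmapE (W : lmodType k) (f : U -> V -> W) u v :
  bilin f -> tmap f (tens u v) = f u v.
Proof.
case=> fl fr.
pose gl v' : {linear U -> W} :=
  HB.pack (f^~ v') (GRing.isLinear.Build k U W _ (f^~ v') (fl v')).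
pose gr u' : {linear V -> W} :=
  HB.pack (f u') (GRing.isLinear.Build k V W _ (f u') (fr u')).
rewrite /tmap [in RHS](coord_vbasis (memvf u)) -[f _ v]/(gl v _) linear_sum.
apply: eq_bigr => i _; rewrite linearZ /=.
rewrite -[f _ v]/(gr _ v) [in RHS](coord_vbasis (memvf v)) linear_sum scaler_sumr.
by apply: eq_bigr => j _; rewrite linearZ /= mxE scalerA mulrC.
Qed.

Lemma tens_decomp (t : tensor U V) :
  t = \sum_i \sum_j t i j *: tens (vbasis {:U})`_i (vbasis {:V})`_j.
Proof.
have cb (X : vectType k) (i j : 'I_(\dim {:X})) :
    coord (vbasis {:X}) i (vbasis {:X})`_j = (i == j)%:R.
  by rewrite (coord_free _ _ (basis_free (vbasisP _))) eq_sym.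
apply/matrixP=> i j; rewrite summxE (bigD1 i) //= summxE (bigD1 j) //=.
rewrite [X in _ + X]big1 => [|i' ni]; last first.
  rewrite summxE big1 // => j' _.
  by rewrite !mxE !cb eq_sym (negPf ni) mul0r mulr0.
rewrite [X in _ + X + _]big1 => [|j' nj]; last first.
  by rewrite !mxE !cb eqxx mul1r eq_sym (negPf nj) mulr0.
by rewrite !mxE !cb !eqxx !mulr1 !addr0.
Qed.

Lemma tmap_unique (W : lmodType k) (g : {linear tensor U V -> W}) :
  g =1 tmap (fun u v => g (tens u v)).
Proof.
move=> t; rewrite {1}[t]tens_decomp linear_sum; apply: eq_bigr => i _.
by rewrite linear_sum; apply: eq_bigr => j _; rewrite linearZ.
Qed.

Lemma tens_ext (W : lmodType k) (f g : {linear tensor U V -> W}) :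
  (forall u v, f (tens u v) = g (tens u v)) -> f =1 g.
Proof.
move=> fg t; rewrite tmap_unique [RHS]tmap_unique.
by apply: eq_bigr => i _; apply: eq_bigr => j _; rewrite fg.
Qed.

End TensorSpace.

Notation "u ⊗ v" := (tens u v) (at level 40, left associativity) : ring_scope.

Section TensorAlgebra.
Variables (k : fieldType) (A B : falgType k).
Implicit Types r s t : tensor A B.

Definition tone : tensor A B := 1 ⊗ 1.
Definition tmul s t : tensor A B :=
  tmap (fun a b => tmap (fun a' b' => (a * a') ⊗ (b * b')) t) s.

Lemma tensDl (a a' : A) (b : B) : (a + a') ⊗ b = a ⊗ b + a' ⊗ b.
Proof. by have := (tens_bilinear A B).1 b 1 a a'; rewrite !scale1r. Qed.
Lemma tensDr (a : A) (b b' : B) : a ⊗ (b + b') = a ⊗ b + a ⊗ b'.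
Proof. by have := (tens_bilinear A B).2 a 1 b b'; rewrite !scale1r. Qed.
Lemma tensZl c (a : A) (b : B) : (c *: a) ⊗ b = c *: (a ⊗ b).
Proof.
have t0 : (0 : A) ⊗ b = 0 by apply: (addrI (0 ⊗ b)); rewrite -tensDl !addr0.
by have := (tens_bilinear A B).1 b c a 0; rewrite t0 !addr0.
Qed.
Lemma tensZr c (a : A) (b : B) : a ⊗ (c *: b) = c *: (a ⊗ b).
Proof.
have t0 : a ⊗ (0 : B) = 0 by apply: (addrI (a ⊗ 0)); rewrite -tensDr !addr0.
by have := (tens_bilinear A B).2 a c b 0; rewrite t0 !addr0.
Qed.

Fact tmul_bil1 a b : bilin (fun (a' : A) (b' : B) => (a * a') ⊗ (b * b')).
Proof.
by split=> [b'|a'] c x y /=;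
  rewrite mulrDr -scalerAr ?tensDl ?tensDr ?tensZl ?tensZr.
Qed.

Fact tmul_bil2 t :
  bilin (fun (a : A) (b : B) => tmap (fun a' b' => (a * a') ⊗ (b * b')) t).
Proof.
by split=> [b|a] c x y /=; apply: tmap_lincomb => a' b';
  rewrite mulrDl -scalerAl ?tensDl ?tensDr ?tensZl ?tensZr.
Qed.

Lemma tmulE a b a' b' : tmul (a ⊗ b) (a' ⊗ b') = (a * a') ⊗ (b * b').
Proof. by rewrite /tmul tmapE; [rewrite tmapE //; apply: tmul_bil1 | apply: tmul_bil2]. Qed.

Fact tmul_linl t : linear (tmul^~ t).
Proof. by move=> c x y; rewrite /tmul linearP. Qed.
Fact tmul_linr s : linear (tmul s).
Proof.
by move=> c x y; apply: tmap_lincomb => a b; rewrite linearP.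
Qed.

Let ml t : {linear tensor A B -> tensor A B} :=
  HB.pack (tmul^~ t) (GRing.isLinear.Build k _ _ _ (tmul^~ t) (tmul_linl t)).
Let mr t : {linear tensor A B -> tensor A B} :=
  HB.pack (tmul t) (GRing.isLinear.Build k _ _ _ (tmul t) (tmul_linr t)).

Fact tmulA : associative tmul.
Proof.
move=> r s t.
apply: (tens_ext (f := ml (tmul s t)) (g := ml t \o ml s)) => a b /=.
apply: (tens_ext (f := mr (a ⊗ b) \o ml t) (g := ml t \o mr (a ⊗ b))) => c d /=.
apply: (tens_ext (f := mr (a ⊗ b) \o mr (c ⊗ d)) (g := mr (tmul (a ⊗ b) (c ⊗ d)))).
by move=> e f /=; rewrite !tmulE !mulrA.
Qed.
Fact tmul1l : left_id tone tmul.
Proof. by move=> t; apply: (tens_ext (f := mr tone) (g := idfun)) => a b /=; rewrite tmulE !mul1r. Qed.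
Fact tmul1r : right_id tone tmul.
Proof. by move=> t; apply: (tens_ext (f := ml tone) (g := idfun)) => a b /=; rewrite tmulE !mulr1. Qed.
Fact tmulDl : left_distributive tmul +%R.
Proof. by move=> x y t; rewrite -[LHS]/(ml t _) linearD. Qed.
Fact tmulDr : right_distributive tmul +%R.
Proof. by move=> t x y; rewrite -[LHS]/(mr t _) linearD. Qed.
Fact tone_neq0 : tone != 0.
Proof.
have nz (X : falgType k) : exists i, coord (vbasis {:X}) i 1 != 0.
  apply/existsP; apply: contraNT (oner_neq0 X) => /existsPn h.
  rewrite (coord_vbasis (memvf (1 : X))) big1 // => i _.
  by rewrite (eqP (negbNE (h i))) scale0r.
case: (nz A) (nz B) => i hi [j hj]; apply/eqP => /matrixP/(_ i j)/eqP.
by rewrite !mxE mulf_eq0 (negPf hi) (negPf hj).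
Qed.

HB.instance Definition _ := GRing.Zmodule_isNzRing.Build (tensor A B)
  tmulA tmul1l tmul1r tmulDl tmulDr tone_neq0.
Fact tmul_scaleAl c (s t : tensor A B) : c *: (s * t) = (c *: s) * t.
Proof. by rewrite -[RHS]/(ml t _) linearZ. Qed.
HB.instance Definition _ :=
  GRing.Lmodule_isLalgebra.Build k (tensor A B) tmul_scaleAl.
Fact tmul_scaleAr c (s t : tensor A B) : c *: (s * t) = s * (c *: t).
Proof. by rewrite -[RHS]/(mr s _) linearZ. Qed.
HB.instance Definition _ :=
  GRing.Lalgebra_isAlgebra.Build k (tensor A B) tmul_scaleAr.
HB.instance Definition _ := Algebra_isFalgebra.Build k (tensor A B).

Lemma tensM (a a' : A) (b b' : B) :
  (a ⊗ b) * (a' ⊗ b') = (a * a') ⊗ (b * b').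
Proof. exact: tmulE. Qed.

End TensorAlgebra.

Definition tassoc (k : fieldType) (U V W : vectType k) :
    tensor U (tensor V W) -> tensor (tensor U V) W :=
  tmap (fun u => tmap (fun v w => (u ⊗ v) ⊗ w)).

Definition tflip (k : fieldType) (U V : vectType k) : tensor U V -> tensor V U :=
  tmap (fun u v => v ⊗ u).

(* f (x) g *)
Definition tmap2 (k : fieldType) (U V U' V' : vectType k)
    (f : U -> U') (g : V -> V') : tensor U V -> tensor U' V' :=
  tmap (fun u v => f u ⊗ g v).

HB.mixin Record isHopfAlgebra (k : fieldType) A of Falgebra k A := {
  comul : {lrmorphism A -> tensor A A};
  counit : {lrmorphism A -> k | *%R};
  antipode : {linear A -> A};
  comulA : forall a : A,
    tmap2 comul idfun (comul a) = tassoc (tmap2 idfun comul (comul a));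
  counitl : forall a : A, tmap (fun x y => counit x *: y) (comul a) = a;
  counitr : forall a : A, tmap (fun x y => counit y *: x) (comul a) = a;
  antipodel : forall a : A,
    tmap (fun x y => antipode x * y) (comul a) = (counit a)%:A;
  antipoder : forall a : A,
    tmap (fun x y => x * antipode y) (comul a) = (counit a)%:A
}.

#[short(type="hopfAlgType")]
HB.structure Definition HopfAlgebra (k : fieldType) :=
  { A of isHopfAlgebra k A & Falgebra k A }.

Section HopfNotions.
Variables (k : fieldType) (A : hopfAlgType k).
Local Notation Delta := (@comul k A).
Local Notation eps := (@counit k A).
Local Notation S := (@antipode k A).
Implicit Types (a b g x : A) (R : tensor A A) (lam : {scalar A}).

Definition leg12 R : tensor (tensor A A) A := tmap (fun x y => (x ⊗ y) ⊗ 1) R.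
Definition leg13 R : tensor (tensor A A) A := tmap (fun x y => (x ⊗ 1) ⊗ y) R.
Definition leg23 R : tensor (tensor A A) A := tmap (fun x y => (1 ⊗ x) ⊗ y) R.

Definition quasitriangular R : Prop :=
  [/\ R \is a GRing.unit,
      forall a, tflip (Delta a) = R * Delta a * R^-1,
      tmap2 Delta idfun R = leg13 R * leg23 R
    & tassoc (tmap2 idfun Delta R) = leg13 R * leg12 R].

Definition grouplike g : Prop := g \is a GRing.unit /\ Delta g = g ⊗ g.

Definition ribbon R g : Prop :=
  [/\ quasitriangular R, grouplike g & forall a, S (S a) = g * a * g^-1].

Definition left_integral x : Prop := forall a, a * x = eps a *: x.
Definition right_integral x : Prop := forall a, x * a = eps a *: x.
Definition integral x : Prop := left_integral x /\ right_integral x.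
Definition unimodular : Prop := forall x, left_integral x <-> right_integral x.

Definition right_cointegral lam : Prop :=
  forall a, tmap (fun x y => lam x *: y) (Delta a) = (lam a)%:A.

Definition star lam a b : A := tmap (fun x y => lam (S a * x) *: y) (Delta b).

Definition Jmap lam R (z : A) : A :=
  tmap (fun x y => lam x *: y) ((z ⊗ 1) * (tflip R * R)).

Lemma JmapE lam n (al be : 'I_n -> A) z :
  Jmap lam (\sum_i al i ⊗ be i) z =
  \sum_i \sum_j lam (z * be i * al j) *: (al i * be j).
Proof.
have bflip : bilin (fun x y : A => y ⊗ x).
  by split=> [v|u] c x y; rewrite /= ?tensDl ?tensDr ?tensZl ?tensZr.
have bsl : bilin (fun x y : A => lam x *: y).
  split=> [v c x y|u c x y] /=; last by rewrite scalerDr !scalerA mulrC.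
  by rewrite linearP scalerDl scalerA.
have fE : tflip (\sum_i al i ⊗ be i) = \sum_i be i ⊗ al i.
  by rewrite /tflip linear_sum; apply: eq_bigr => i _; exact: tmapE.
rewrite /Jmap fE.
rewrite mulrA [(z ⊗ 1) * _]mulr_sumr mulr_suml linear_sum; apply: eq_bigr => i _ /=.
rewrite mulr_sumr linear_sum; apply: eq_bigr => j _ /=.
by rewrite !tensM tmapE // mul1r.
Qed.

Fact Jmap_is_linear lam R : linear (Jmap lam R).
Proof.
move=> c x y; rewrite /Jmap tensDl tensZl mulrDl -scalerAl.
by rewrite linearP.
Qed.
HB.instance Definition _ lam R :=
  GRing.isLinear.Build k A A _ (Jmap lam R) (Jmap_is_linear lam R).

Definition center : {aspace A} := 'Z({:A})%AS.
Local Notation ZA := (subvs_of center).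

Lemma centerP a : reflect (forall b, a * b = b * a) (a \in center).
Proof.
rewrite /= memv_cap memvf /=.
by apply: (iffP centvP) => h b; [rewrite h ?memvf | move=> _; rewrite h].
Qed.

Fact ZmulC : commutative (@GRing.mul ZA).
Proof. by move=> u v; apply/val_inj/centerP/subvsP. Qed.

End HopfNotions.

Section QuotientCenter.
Variables (k : fieldType) (A : hopfAlgType k) (lam : {scalar A}).
Local Notation ZA := (subvs_of (center A)).

Fact Kform_linear (b : ZA) : scalar (fun a : ZA => lam (vsval a * vsval b)).
Proof. by move=> c u v; rewrite linearP /= mulrDl -scalerAl linearP. Qed.
Definition Kform (b : ZA) : {linear ZA -> k^o} :=
  HB.pack (fun a : ZA => lam (vsval a * vsval b) : k^o)
    (GRing.isLinear.Build k ZA k^o _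
       (fun a : ZA => lam (vsval a * vsval b) : k^o) (@Kform_linear b)).

(* K(A), as a subspace of Z(A): by linearity b may range over a basis of Z(A) *)
Definition Kspace : {vspace ZA} :=
  (\bigcap_(i < \dim {:ZA}) lker (linfun (Kform (vbasis {:ZA})`_i)))%VS.

Lemma KspaceP (a : ZA) :
  reflect (forall b, b \in center A -> lam (vsval a * b) = 0) (a \in Kspace).
Proof.
rewrite /Kspace memvE; apply: (iffP subv_bigcapP) => [h b bZ|h i _]; last first.
  by rewrite -memvE memv_ker lfunE /= h ?subvsP.
rewrite -[b](vsprojK bZ) {1}(coord_vbasis (memvf (vsproj (center A) b))).
rewrite linear_sum mulr_sumr linear_sum big1 // => i _.
have := h i isT; rewrite -memvE memv_ker lfunE /= => /eqP e.
by rewrite -scalerAr linearZ /= e mulr0.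
Qed.

Definition Zhat : Type := {quot (pred_of_vspace Kspace)}.
HB.instance Definition _ := GRing.Zmodule.on Zhat.

Definition Zhat_pi (z : ZA) : Zhat := \pi_{quot (pred_of_vspace Kspace)} z.
Definition Zhat_repr (x : Zhat) : ZA := @repr _ {quot (pred_of_vspace Kspace)} x.

Lemma Zhat_reprK x : Zhat_pi (Zhat_repr x) = x.
Proof. exact: reprK. Qed.
Lemma Zhat_piP z z' : reflect (Zhat_pi z = Zhat_pi z') (z - z' \in Kspace).
Proof. by rewrite [_ \in _](idealrBE (pred_of_vspace Kspace)); apply: eqP. Qed.
Lemma Zhat_piD z z' : Zhat_pi (z + z') = Zhat_pi z + Zhat_pi z'.
Proof. exact: (pi_add (pred_of_vspace Kspace)). Qed.

Definition Zhat_one : Zhat := Zhat_pi 1.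
Definition Zhat_mul (x y : Zhat) : Zhat := Zhat_pi (Zhat_repr x * Zhat_repr y).
Definition Zhat_scale (c : k) (x : Zhat) : Zhat := Zhat_pi (c *: Zhat_repr x).

Fact Kspace_mull z z' : z' \in Kspace -> z * z' \in Kspace.
Proof.
move=> /KspaceP Kz'; apply/KspaceP => b bZ; rewrite ZmulC /= -mulrA Kz' //.
by rewrite -[b](vsprojK bZ) -[_ * _]/(vsval (z * _)) subvsP.
Qed.
Lemma Zhat_piM z z' : Zhat_pi (z * z') = Zhat_mul (Zhat_pi z) (Zhat_pi z').
Proof.
apply/Zhat_piP; set r := Zhat_repr _; set r' := Zhat_repr _.
have -> : z * z' - r * r' = z * (z' - r') + r' * (z - r).
  by rewrite mulrBr mulrBr [r' * z]ZmulC [r' * r]ZmulC addrA subrK.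
by rewrite memvD // Kspace_mull //; apply/Zhat_piP; rewrite Zhat_reprK.
Qed.
Lemma Zhat_piZ c z : Zhat_pi (c *: z) = Zhat_scale c (Zhat_pi z).
Proof.
apply/Zhat_piP; rewrite -scalerBr memvZ //; apply/Zhat_piP.
by rewrite Zhat_reprK.
Qed.

Fact Zhat_mulA : associative Zhat_mul.
Proof.
move=> x y z; rewrite -[x]Zhat_reprK -[y]Zhat_reprK -[z]Zhat_reprK.
by rewrite -!Zhat_piM mulrA.
Qed.
Fact Zhat_mulC : commutative Zhat_mul.
Proof. by move=> x y; rewrite /Zhat_mul ZmulC. Qed.
Fact Zhat_mul1 : left_id Zhat_one Zhat_mul.
Proof. by move=> x; rewrite -[x]Zhat_reprK -Zhat_piM mul1r. Qed.
Fact Zhat_mulD : left_distributive Zhat_mul +%R.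
Proof.
move=> x y z; rewrite -[x]Zhat_reprK -[y]Zhat_reprK -[z]Zhat_reprK.
by rewrite -Zhat_piD -!Zhat_piM mulrDl Zhat_piD.
Qed.
HB.instance Definition _ := GRing.Zmodule_isComPzRing.Build Zhat
  Zhat_mulA Zhat_mulC Zhat_mul1 Zhat_mulD.

Fact Zhat_scaleA a b x : Zhat_scale a (Zhat_scale b x) = Zhat_scale (a * b) x.
Proof. by rewrite -[x]Zhat_reprK -!Zhat_piZ scalerA. Qed.
Fact Zhat_scale1 : left_id 1 Zhat_scale.
Proof. by move=> x; rewrite -[x]Zhat_reprK -Zhat_piZ scale1r. Qed.
Fact Zhat_scaleDr : right_distributive Zhat_scale +%R.
Proof.
move=> c x y; rewrite -[x]Zhat_reprK -[y]Zhat_reprK.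
by rewrite -Zhat_piD -!Zhat_piZ scalerDr Zhat_piD.
Qed.
Fact Zhat_scaleDl x : {morph Zhat_scale^~ x : a b / a + b}.
Proof.
by move=> a b; rewrite /= -[x]Zhat_reprK -!Zhat_piZ scalerDl Zhat_piD.
Qed.
HB.instance Definition _ := GRing.Zmodule_isLmodule.Build k Zhat
  Zhat_scaleA Zhat_scale1 Zhat_scaleDr Zhat_scaleDl.

(* [a]; meaningful for a in Z(A), on which vsproj is the identity *)
Definition Zclass (a : A) : Zhat := Zhat_pi (vsproj (center A) a).

(* The product induced by star, computed on chosen representatives; that it   *)
(* is independent of them is not built in.                                    *)
Definition Zhat_star (x y : Zhat) : Zhat :=
  Zclass (star lam (vsval (Zhat_repr x)) (vsval (Zhat_repr y))).

Definition ZhatS (x : Zhat) : Prop :=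
  exists2 a, a \in center A & x = Zclass a /\ Zclass (antipode a) = Zclass a.

Lemma ZclassP a b : a \in center A -> b \in center A ->
  (Zclass a = Zclass b) <->
  (forall c, c \in center A -> lam ((a - b) * c) = 0).
Proof.
move=> aZ bZ; rewrite /Zclass; split=> [/Zhat_piP/KspaceP|] h.
  by move=> c /h /=; rewrite !vsprojK.
by apply/Zhat_piP/KspaceP => c /h /=; rewrite !vsprojK.
Qed.

End QuotientCenter.

(* Main.v *)
From HB Require Import structures.
Require Import Defs.
From mathcomp Require Import all_boot all_order all_algebra all_field.

Set Implicit Arguments.
Unset Strict Implicit.
Unset Printing Implicit Defensive.

Import GRing.Theory.
Local Open Scope ring_scope.

(* Write Q = R21 R, and lam_a for the functional x |-> lam (a x).  Expanding   *)
(* the integral Lam as a dual basis gives lam (y x) = lam (S^2(x) y); hence    *)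
(* for a central lam_a is an S^2-trace, and since Q commutes with every        *)
(* Delta(c), J(a) = (lam_a (x) 1) Q is central.                                *)
(* (a) lam_(a star b) is the convolution of lam_a and lam_b, and by the        *)
(*     hexagon axioms p |-> (p (x) 1) Q is multiplicative on convolutions when *)
(*     its first factor has a central image.                                   *)
(* (b) The hexagon axioms also expand Delta(J(1)); moving one R-matrix leg     *)
(*     around the trace lam and using (S^2 (x) S^2) R = R yields J(J(a)).      *)
(* (c) lam (J(a) b) = lam (a J(b)), so J preserves K(A).  Two S^2-traces       *)
(*     commute under convolution because R conjugates Delta to its opposite,   *)
(*     so star is commutative on the center; applying eps to                   *)
(*     a star 1 = 1 star a gives lam o S = lam on the center.  The two partial *)
(*     traces (lam_a (x) 1) Q and (1 (x) lam o S o (b .)) Q are both central,  *)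
(*     so S may be dropped one leg at a time, and lam (S(a) J(S(b))) =         *)
(*     lam (J(a) b): modulo K(A), J commutes with S.                           *)

(** Two twisted symmetries carry the argument. Slicing the coproduct of [Lam] by [lam] gives dual
    bases ([dual_basisl], [dual_basisr], [integral_decomp]), so the form lam (x y) is nondegenerate
    with Nakayama automorphism S^2 ([cointegral_inj], [cointegral_trace]). And R is invariant under
    S (x) S ([Rmatrix_SS]). Hence a leg of R can be carried around a trace lam_a with a central: the
    S^2 it picks up is balanced by an S^2 on its partner leg ([slicel_monodromy_trace]). The inverse
    of S used throughout comes from the ribbon element ([ribbon_antipode_bij]).

    Part (a) is [slicel_monodromyM] applied to lam_a and lam_b, whose convolution represents a star
    b ([cointegral_star]); part (b) is [Jmap_Jmap].

    For (c), K(A) is the radical of the form lam (a b) on Z(A), so any map of Z(A) with an adjoint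
    for this form descends. J is its own adjoint ([cointegral_JmapC]), and the adjoint of b |-> a
    star b is slicing the coproduct by lam_a ([cointegral_starr], [comul_slice_center]); the other
    argument of star follows by [starC]. Stability of the S-fixed classes comes from
    [cointegral_Jmap_antipode]. *)

Definition lin (k : fieldType) (U V : lmodType k) (f : U -> V) : Prop :=
  forall c x y, f (c *: x + y) = c *: f x + f y.

(** * Linearity as a predicate on bare functions, proved by the syntax of the term *)

Section Linearity.
Variable k : fieldType.

Lemma lin_bilin (U V W : lmodType k) (f : U -> V -> W) :
  (forall v, lin (f^~ v)) -> (forall u, lin (f u)) -> bilin f.
Proof. by []. Qed.

Lemma lin_id (U : lmodType k) : lin (fun x : U => x).
Proof. by []. Qed.

Lemma lin_linear (U V : lmodType k) (f : {linear U -> V}) : lin f.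
Proof. exact: linearP. Qed.

Lemma lin_scalar (U : lmodType k) (f : {scalar U}) : @lin k U k^o f.
Proof. exact: linearP. Qed.

Lemma lin_comp (U V W : lmodType k) (f : V -> W) (g : U -> V) :
  lin f -> lin g -> lin (fun x => f (g x)).
Proof. by move=> lf lg c x y; rewrite lg lf. Qed.

Lemma lin_scalar_comp (U V : lmodType k) (f : {scalar V}) (g : U -> V) :
  lin g -> @lin k U k^o (fun x => f (g x)).
Proof. by move=> lg c x y; rewrite lg linearP. Qed.

Lemma lin_mull (U : lmodType k) (B : algType k) (b : B) (g : U -> B) :
  lin g -> lin (fun x => b * g x).
Proof. by move=> lg c x y; rewrite lg mulrDr -scalerAr. Qed.

Lemma lin_mulr (U : lmodType k) (B : algType k) (b : B) (g : U -> B) :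
  lin g -> lin (fun x => g x * b).
Proof. by move=> lg c x y; rewrite lg mulrDl -scalerAl. Qed.

Lemma lin_kmull (U : lmodType k) (b : k) (g : U -> k) :
  @lin k U k^o g -> @lin k U k^o (fun x => b * g x).
Proof. by move=> lg c x y; rewrite lg mulrDr /GRing.scale /= mulrCA. Qed.

Lemma lin_kmulr (U : lmodType k) (b : k) (g : U -> k) :
  @lin k U k^o g -> @lin k U k^o (fun x => g x * b).
Proof. by move=> lg c x y; rewrite lg mulrDl /GRing.scale /= mulrA. Qed.

Lemma lin_scalel (U V : lmodType k) (g : U -> k) (v : V) :
  @lin k U k^o g -> lin (fun x => g x *: v).
Proof. by move=> lg c x y; rewrite lg scalerDl scalerA. Qed.

Lemma lin_scaler (U V : lmodType k) (s : k) (g : U -> V) :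
  lin g -> lin (fun x => s *: g x).
Proof. by move=> lg c x y; rewrite lg scalerDr !scalerA mulrC. Qed.

Lemma lin_tensl (U : lmodType k) (V W : vectType k) (g : U -> V) (w : W) :
  lin g -> lin (fun x => g x ⊗ w).
Proof. by move=> lg c x y; rewrite lg (tens_bilinear V W).1. Qed.

Lemma lin_tensr (U : lmodType k) (V W : vectType k) (v : V) (g : U -> W) :
  lin g -> lin (fun x => v ⊗ g x).
Proof. by move=> lg c x y; rewrite lg (tens_bilinear V W).2. Qed.

Lemma lin_tmap (V W : vectType k) (U X : lmodType k) (f : V -> W -> X)
  (t : U -> tensor V W) : lin t -> lin (fun x => tmap f (t x)).
Proof. by move=> lt c x y; rewrite lt linearP. Qed.

Lemma lin_tmapf (V W : vectType k) (U X : lmodType k) (f : U -> V -> W -> X)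
  (t : tensor V W) :
  (forall v w, lin (fun x => f x v w)) -> lin (fun x => tmap (f x) t).
Proof. by move=> lf c x y; apply: tmap_lincomb => v w; apply: lf. Qed.

End Linearity.

Section SweedlerSum.
Variables (k : fieldType) (A : hopfAlgType k).
Local Notation Delta := (@comul k A).

(* [sw f a] is the Sweedler sum of the f (a_(1)) (a_(2)). *)
Definition sw (W : lmodType k) (f : A -> A -> W) (a : A) : W :=
  tmap f (Delta a).

Lemma lin_sw (W U : lmodType k) (f : A -> A -> W) (g : U -> A) :
  lin g -> lin (fun x => sw f (g x)).
Proof.
move=> lg; rewrite /sw; apply: lin_tmap.
by apply: (lin_comp (f := Delta)) => //; apply: lin_linear.
Qed.

Lemma lin_swf (W U : lmodType k) (f : U -> A -> A -> W) (a : A) :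
  (forall v w, lin (fun x => f x v w)) -> lin (fun x => sw (f x) a).
Proof. exact: lin_tmapf. Qed.

End SweedlerSum.

(* The eta-expansion keeps the binder visible to the patterns. *)
Ltac lin_tac := intros;
  lazymatch goal with
  | |- bilin _ => apply: lin_bilin => ?; lin_tac
  | |- @lin ?k ?U ?V ?f => change (@lin k U V (fun x => f x)); cbv beta;
    first
    [ solve [auto 2] | exact: lin_id | exact: lin_linear | exact: lin_scalar
    | match goal with
      | H : bilin ?f |- lin (fun x => ?f x ?b) => exact: (H.1 b)
      | H : bilin ?f |- lin (fun x => ?f ?a x) => exact: (H.2 a)
      | |- lin (fun x => sw (fun u v => @?f x u v) _) =>
          apply: lin_swf; lin_tac
      | |- lin (fun x => sw _ (@?t x)) => apply: lin_sw; lin_tac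
      | |- lin (fun x => tmap (fun u v => @?f x u v) _) =>
          apply: lin_tmapf; lin_tac
      | |- lin (fun x => tmap _ (@?t x)) => apply: lin_tmap; lin_tac
      | |- lin (fun x => _ ⊗ (@?g x)) => apply: lin_tensr; lin_tac
      | |- lin (fun x => (@?g x) ⊗ _) => apply: lin_tensl; lin_tac
      | |- lin (fun x => _ *: (@?g x)) => apply: lin_scaler; lin_tac
      | |- lin (fun x => (@?g x) *: _) => apply: lin_scalel; lin_tac
      | |- lin (fun x => _ * (@?g x)) =>
          first [apply: lin_mull | apply: lin_kmull]; lin_tac
      | |- lin (fun x => (@?g x) * _) =>
          first [apply: lin_mulr | apply: lin_kmulr]; lin_tac
      | |- lin (fun x => _ (@?g x)) => apply: lin_scalar_comp; lin_tac
      | |- lin (fun x => ?f (@?g x)) =>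
          lazymatch g with (fun x => x) => fail | _ => idtac end;
          apply: (lin_comp (f := f) (g := g)); lin_tac
      | |- lin (fun x => ?f (@?g x) ?b) =>
          lazymatch g with (fun x => x) => fail | _ => idtac end;
          apply: (lin_comp (f := fun u => f u b) (g := g)); lin_tac
      end ]
  end.

(** * Calculus of induced maps on tensor products *)

Section Tmap.
Variable k : fieldType.
Implicit Types (U V : vectType k) (W X : lmodType k).

Lemma eq_tmap U V W (f g : U -> V -> W) t :
  (forall u v, f u v = g u v) -> tmap f t = tmap g t.
Proof.
by move=> fg; apply: eq_bigr => i _; apply: eq_bigr => j _; rewrite fg.
Qed.

Lemma lin_sum W X (I : Type) (r : seq I) (P : pred I) (F : I -> W) (f : W -> X) :
  lin f -> f (\sum_(i <- r | P i) F i) = \sum_(i <- r | P i) f (F i).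
Proof.
move=> lf; pose f' : {linear W -> X} := HB.pack f
  (GRing.isLinear.Build k W X _ f lf).
by rewrite -[f _]/(f' _) linear_sum.
Qed.

Lemma linZ W X (f : W -> X) c v : lin f -> f (c *: v) = c *: f v.
Proof.
move=> lf; pose f' : {linear W -> X} := HB.pack f
  (GRing.isLinear.Build k W X _ f lf).
by rewrite -[f _]/(f' _) linearZ.
Qed.

Lemma lin_tmap_comp U V W X (f : U -> V -> W) (h : W -> X) t :
  lin h -> h (tmap f t) = tmap (fun u v => h (f u v)) t.
Proof.
move=> lh; rewrite /tmap lin_sum //; apply: eq_bigr => i _.
by rewrite lin_sum //; apply: eq_bigr => j _; rewrite linZ.
Qed.

Arguments lin_tmap_comp {U V W X f h t}.

(** An exchange of finite sums; it reorders independent copies of [R] and of coproducts in Sweedler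
    computations. *)
Lemma tmap_swap U V (U' V' : vectType k) W (f : U -> V -> U' -> V' -> W) s t :
  tmap (fun x y => tmap (f x y) s) t =
  tmap (fun u v => tmap (fun x y => f x y u v) t) s.
Proof.
rewrite [RHS](_ : _ = tmap (fun u v => \sum_i \sum_j t i j *:
   f (vbasis {:U})`_i (vbasis {:V})`_j u v) s) //.
rewrite /tmap.
under eq_bigr => i _ do under eq_bigr => j _ do rewrite scaler_sumr.
under [RHS]eq_bigr => i _ do under eq_bigr => j _ do rewrite scaler_sumr.
under eq_bigr => i _ do (under eq_bigr => j _ do
  under eq_bigr => l _ do rewrite scaler_sumr).
under [RHS]eq_bigr => i _ do (under eq_bigr => j _ do
  under eq_bigr => l _ do rewrite scaler_sumr).
rewrite pair_bigA /= [RHS]pair_bigA /=.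
under eq_bigr => i _ do rewrite pair_bigA /=.
under [RHS]eq_bigr => i _ do rewrite pair_bigA /=.
rewrite exchange_big; apply: eq_bigr => i _; apply: eq_bigr => j _ /=.
by rewrite !scalerA mulrC.
Qed.

Lemma tmap_tmap U V (U' V' : vectType k) W (f : U' -> V' -> W)
  (h : U -> V -> tensor U' V') t :
  tmap f (tmap h t) = tmap (fun u v => tmap f (h u v)) t.
Proof. by apply: lin_tmap_comp; lin_tac. Qed.

Lemma tmap_tens U V (t : tensor U V) : tmap (fun u v => u ⊗ v) t = t.
Proof.
rewrite -[RHS]/(idfun t).
by rewrite (tmap_unique (idfun : {linear tensor U V -> tensor U V})).
Qed.

Lemma tmap_flip U V W (f : V -> U -> W) (t : tensor U V) : bilin f ->
  tmap f (tflip t) = tmap (fun u v => f v u) t.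
Proof.
by move=> bf; rewrite /tflip tmap_tmap; apply: eq_tmap => u v; rewrite tmapE.
Qed.

Lemma tmapM (A B : falgType k) W (f : A -> B -> W) s t : bilin f ->
  tmap f (s * t) =
  tmap (fun x y => tmap (fun x' y' => f (x * x') (y * y')) t) s.
Proof.
move=> bf; rewrite -{1}(tmap_tens s) (lin_tmap_comp (h := fun s => s * t));
  last by lin_tac.
rewrite tmap_tmap; apply: eq_tmap => x y.
rewrite -{1}(tmap_tens t) (lin_tmap_comp (h := fun t => _ * t)); last by lin_tac.
by rewrite tmap_tmap; apply: eq_tmap => x' y'; rewrite tensM tmapE.
Qed.

End Tmap.

Arguments lin_tmap_comp {k U V W X f h t}.

Section SweedlerCalculus.
Variables (k : fieldType) (A : hopfAlgType k).

Lemma eq_sw (W : lmodType k) (f g : A -> A -> W) a :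
  (forall u v, f u v = g u v) -> sw f a = sw g a.
Proof. exact: eq_tmap. Qed.

Lemma sw_comp (W X : lmodType k) (f : A -> A -> W) (h : W -> X) a :
  lin h -> h (sw f a) = sw (fun u v => h (f u v)) a.
Proof. exact: lin_tmap_comp. Qed.

Lemma sw_tens a : sw (fun x y => x ⊗ y) a = @comul k A a.
Proof. exact: tmap_tens. Qed.

End SweedlerCalculus.
Arguments sw_comp {k A W X f h a}.

(** * Hopf algebra axioms in Sweedler form, and the antipode as an anti-homomorphism *)

Section HopfBasics.
Variables (k : fieldType) (A : hopfAlgType k).
Local Notation Delta := (@comul k A).
Local Notation eps := (@counit k A).
Local Notation S := (@antipode k A).
Implicit Types (W : lmodType k) (a b c : A).

Definition trilin W (f : A -> A -> A -> W) :=
  [/\ forall y z, lin (fun x => f x y z), forall x z, lin (fun y => f x y z)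
    & forall x y, lin (fun z => f x y z)].

(** Coassociativity: a trilinear [f] induces a map on the triple tensor product, under which both
    sides of [comulA] are evaluated. *)
Lemma swA W (f : A -> A -> A -> W) a : trilin f ->
  sw (fun x z => sw (fun x1 x2 => f x1 x2 z) x) a =
  sw (fun x y => sw (fun y1 y2 => f x y1 y2) y) a.
Proof.
case=> f1 f2 f3.
pose G (t : tensor A A) (z : A) := tmap (fun x y => f x y z) t.
have bG : bilin G by rewrite /G; lin_tac.
have /(congr1 (tmap G)) := comulA a.
rewrite /tmap2 /tassoc !tmap_tmap /sw => e.
transitivity (tmap (fun x z => tmap G (Delta x ⊗ z)) (Delta a)).
  by apply: eq_tmap => x z; rewrite tmapE.
rewrite {}e; apply: eq_tmap => x y.
rewrite tmapE; last by lin_tac.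
rewrite tmap_tmap; apply: eq_tmap => u v; rewrite tmapE // /G tmapE //.
by lin_tac.
Qed.

Lemma swM W (f : A -> A -> W) a b : bilin f ->
  sw f (a * b) = sw (fun x y => sw (fun u v => f (x * u) (y * v)) b) a.
Proof. by move=> bf; rewrite /sw rmorphM tmapM. Qed.

Lemma sw1 W (f : A -> A -> W) : bilin f -> sw f 1 = f 1 1.
Proof. by move=> bf; rewrite /sw rmorph1 tmapE. Qed.

Lemma sw_counitl W (f : A -> W) a : lin f -> sw (fun x y => eps x *: f y) a = f a.
Proof.
move=> lf; rewrite -{2}[a]counitl (lin_tmap_comp lf).
by apply: eq_tmap => x y; rewrite linZ.
Qed.

Lemma sw_counitr W (f : A -> W) a : lin f -> sw (fun x y => eps y *: f x) a = f a.
Proof.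
move=> lf; rewrite -{2}[a]counitr (lin_tmap_comp lf).
by apply: eq_tmap => x y; rewrite linZ.
Qed.

Lemma sw_antipodel W (f : A -> W) a : lin f ->
  sw (fun x y => f (S x * y)) a = eps a *: f 1.
Proof. by move=> lf; rewrite -(linZ _ _ lf) -antipodel (lin_tmap_comp lf). Qed.

Lemma sw_antipoder W (f : A -> W) a : lin f ->
  sw (fun x y => f (x * S y)) a = eps a *: f 1.
Proof. by move=> lf; rewrite -(linZ _ _ lf) -antipoder (lin_tmap_comp lf). Qed.

Lemma antipode1 : S 1 = 1.
Proof.
have := antipodel (1 : A); rewrite -[tmap _ _]/(sw _ 1) sw1; last by lin_tac.
by rewrite mulr1 rmorph1 scale1r.
Qed.

Lemma counitM a b : eps (a * b) = eps a * eps b.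
Proof. by rewrite rmorphM. Qed.

Lemma antipodeM a b : S (a * b) = S b * S a.
Proof.
(* Both sides are contractions of S(c1 b1) c2 b2 S(b3): either b2 S(b3) collapses, or S(c1 b1) c2 b2
   does. *)
have step c : sw (fun x y => S (x * b) * y) c = eps c *: S b.
  transitivity (sw (fun u v => eps (c * u) *: S v) b); last first.
    rewrite -(sw_counitl (f := fun v => eps c *: S v)); last by lin_tac.
    by apply: eq_sw => u v; rewrite counitM !scalerA mulrC.
  transitivity (sw (fun u v => sw (fun u1 u2 =>
    sw (fun x y => S (x * u1) * (y * u2) * S v) c) u) b); last first.
    apply: eq_sw => u v; rewrite -[X in _ *: X]mul1r.
    rewrite -(sw_antipodel (f := fun t => t * S v)); last by lin_tac.
    rewrite swM; last by lin_tac.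
    by rewrite /sw tmap_swap.
  rewrite (swA (f := fun u1 u2 v => sw (fun x y => S (x * u1) * (y * u2) * S v) c));
    last by split; lin_tac.
  rewrite -(sw_counitr (f := fun u => sw (fun x y => S (x * u) * y) c));
    last by lin_tac.
  apply: eq_sw => u v.
  transitivity (sw (fun v1 v2 => sw (fun x y => S (x * u) * (y * (v1 * S v2))) c) v).
    rewrite (sw_antipoder (f := fun t => sw (fun x y => S (x * u) * (y * t)) c));
      last by lin_tac.
    by congr (_ *: _); apply: eq_sw => x y; rewrite mulr1.
  by do 2!apply: eq_sw => ? ?; rewrite !mulrA.
(* S(ab) = S(a1 b) a2 S(a3), whose first two factors contract by [step]. *)
transitivity (sw (fun x y => sw (fun u v => S (u * b) * v) x * S y) a).
  rewrite -(sw_counitr (f := fun a => S (a * b))); last by lin_tac.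
  transitivity (sw (fun x y => sw (fun u v => S (x * b) * (u * S v)) y) a).
    apply: eq_sw => x y.
    by rewrite (sw_antipoder (f := fun t => S (x * b) * t)) ?mulr1 //; lin_tac.
  rewrite -(swA (f := fun x u v => S (x * b) * (u * S v))); last by split; lin_tac.
  apply: eq_sw => x y.
  rewrite (sw_comp (h := fun t => t * S y)); last by lin_tac.
  by apply: eq_sw => u v; rewrite mulrA.
rewrite -[RHS](sw_counitl (f := fun a => S b * S a)); last by lin_tac.
by apply: eq_sw => x y; rewrite step scalerAl.
Qed.

End HopfBasics.

Section ComulAntipode.
Variables (k : fieldType) (A : hopfAlgType k).
Local Notation Delta := (@comul k A).
Local Notation eps := (@counit k A).
Local Notation S := (@antipode k A).
Implicit Types (W : lmodType k) (a b c : A).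

(** Uniqueness of convolution inverses: [Delta] composed with S is a left inverse of [Delta], and
    [nu] is a right inverse. *)
Lemma comul_antipode a : Delta (S a) = sw (fun x y => S y ⊗ S x) a.
Proof.
pose nu a := sw (fun x y => S y ⊗ S x) a.
have linv c : sw (fun x y => Delta x * nu y) c = eps c *: 1.
  transitivity (sw (fun x v => sw (fun p q =>
      sw (fun r s => (p * S s) ⊗ (q * S r)) v) x) c).
    apply: eq_sw => x v; rewrite -[X in X * _]sw_tens.
    rewrite (sw_comp (h := fun t => t * nu v)); last by lin_tac.
    apply: eq_sw => p q; rewrite (sw_comp (h := fun t => _ * t)); last by lin_tac.
    by apply: eq_sw => r s; rewrite tensM.
  rewrite (swA (f := fun p q v => sw (fun r s => (p * S s) ⊗ (q * S r)) v));
    last by split; lin_tac.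
  transitivity (sw (fun p w => (p * S w) ⊗ (1 : A)) c); last first.
    by rewrite (sw_antipoder (f := fun t => t ⊗ (1 : A))) //; lin_tac.
  apply: eq_sw => p w.
  rewrite -(swA (f := fun q r s => (p * S s) ⊗ (q * S r))); last by split; lin_tac.
  rewrite -[RHS](sw_counitl (f := fun w => (p * S w) ⊗ (1 : A))); last by lin_tac.
  apply: eq_sw => z s.
  by rewrite (sw_antipoder (f := fun t => (p * S s) ⊗ t)) //; lin_tac.
transitivity (sw (fun x y => sw (fun u v => Delta (S x) * (Delta u * nu v)) y) a).
  rewrite -[LHS](sw_counitr (f := fun a => Delta (S a))); last by lin_tac.
  apply: eq_sw => x y.
  rewrite -(sw_comp (h := fun t => _ * t)); last by lin_tac.
  by rewrite linv -scalerAr mulr1.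
rewrite -(swA (f := fun x u v => Delta (S x) * (Delta u * nu v)));
  last by rewrite /nu; split; lin_tac.
rewrite -[RHS]/(nu a) -[RHS](sw_counitl (f := nu)); last by rewrite /nu; lin_tac.
apply: eq_sw => x y.
rewrite -[nu y in RHS]mul1r scalerAl -[1 in RHS](rmorph1 Delta).
rewrite -(sw_antipodel (f := Delta)); last by lin_tac.
rewrite (sw_comp (h := fun t => t * _)); last by lin_tac.
by apply: eq_sw => u v; rewrite rmorphM mulrA.
Qed.

Lemma sw_antipode W (f : A -> A -> W) a : bilin f ->
  sw f (S a) = sw (fun x y => f (S y) (S x)) a.
Proof.
move=> bf; rewrite /sw comul_antipode tmap_tmap; apply: eq_tmap => x y.
by rewrite tmapE.
Qed.

End ComulAntipode.

(** * Integrals, dual bases and the twisted trace property of the cointegral *)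

Section Cointegral.
Variables (k : fieldType) (A : hopfAlgType k) (lam : {scalar A}).
Local Notation Delta := (@comul k A).
Local Notation eps := (@counit k A).
Local Notation S := (@antipode k A).
Implicit Types (W : lmodType k) (a b c x y : A).
Hypothesis lamP : right_cointegral lam.

Lemma sw_cointegral W (f : A -> W) a : lin f ->
  sw (fun x y => lam x *: f y) a = lam a *: f 1.
Proof.
move=> lf; rewrite -(linZ _ _ lf) -lamP (lin_tmap_comp lf).
by apply: eq_tmap => x y; rewrite linZ.
Qed.

(** Invariance of [lam] applied to x b1 turns lam (x b1) S(b2) into lam (x1 b1) x2 b2 S(b3), where
    b2 S(b3) collapses. *)
Lemma cointegral_moveS b x :
  sw (fun x1 x2 => lam (x1 * b) *: x2) x = sw (fun b1 b2 => lam (x * b1) *: S b2) b.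
Proof.
symmetry; transitivity (sw (fun b' b3 => sw (fun b1 b2 =>
    sw (fun x1 x2 => lam (x1 * b1) *: (x2 * (b2 * S b3))) x) b') b).
  apply: eq_sw => b' b3; rewrite -[S b3]mul1r.
  rewrite -(sw_cointegral (f := fun t => t * S b3)); last by lin_tac.
  rewrite swM; last by lin_tac.
  rewrite /sw tmap_swap; do 2!apply: eq_tmap => ? ?.
  by rewrite mul1r mulrA.
rewrite (swA (f := fun b1 b2 b3 => sw (fun x1 x2 => lam (x1 * b1) *: (x2 * (b2 * S b3))) x));
  last by split; lin_tac.
rewrite -[RHS](sw_counitr (f := fun b => sw (fun x1 x2 => lam (x1 * b) *: x2) x));
  last by lin_tac.
apply: eq_sw => u w.
rewrite (sw_antipoder (f := fun t => sw (fun x1 x2 => lam (x1 * u) *: (x2 * t)) x));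
  last by lin_tac.
by congr (_ *: _); apply: eq_sw => x1 x2; rewrite mulr1.
Qed.

Variable Si : {linear A -> A}.
Hypotheses (SK : cancel S Si) (SiK : cancel Si S).

Lemma SiM a b : Si (a * b) = Si b * Si a.
Proof. by apply: (can_inj SK); rewrite antipodeM !SiK. Qed.

Lemma cointegral_moveSi b a :
  sw (fun b1 b2 => lam (a * b1) *: b2) b = sw (fun a1 a2 => lam (a1 * b) *: Si a2) a.
Proof.
transitivity (Si (sw (fun a1 a2 => lam (a1 * b) *: a2) a)); last first.
  rewrite (sw_comp (h := Si)); last by lin_tac.
  by apply: eq_sw => ? ?; rewrite linearZ.
rewrite cointegral_moveS (sw_comp (h := Si)); last by lin_tac.
by apply: eq_sw => ? ?; rewrite linearZ /= SK.
Qed.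

Variable Lam : A.
Hypotheses (LamP : integral Lam) (lamLam : lam Lam = 1).

(** Moving the coproduct from [Lam] to [a] leaves lam (a1 Lam) Si(a2), and [Lam] absorbs a1 into its
    counit. So the form lam (a x) determines a. *)
Lemma dual_basisl a : sw (fun x y => lam (a * x) *: y) Lam = Si a.
Proof.
rewrite cointegral_moveSi -[RHS](sw_counitl (f := Si)); last by lin_tac.
by apply: eq_sw => x y; rewrite LamP.1 linearZ /= lamLam mulr1.
Qed.

Lemma dual_basisr a : sw (fun x y => lam (x * a) *: y) Lam = S a.
Proof.
rewrite cointegral_moveS -[RHS](sw_counitl (f := S)); last by lin_tac.
by apply: eq_sw => x y; rewrite LamP.2 linearZ /= lamLam mulr1.
Qed.

Lemma cointegral_inj a b : (forall x, lam (a * x) = lam (b * x)) -> a = b.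
Proof.
move=> ab; apply: (can_inj SiK); rewrite -!dual_basisl.
by apply: eq_sw => x y; rewrite ab.
Qed.

Lemma antipode_integral : S Lam = Lam.
Proof.
rewrite -[RHS]SiK; congr (S _); rewrite -dual_basisl.
rewrite -[LHS](sw_counitl (f := fun x => x)) //.
by apply: eq_sw => x y; rewrite LamP.2 linearZ /= lamLam mulr1.
Qed.

(** This is [dual_basisr] for y, read on S Lam = Lam: the antipode swaps the two legs, and the S
    left on the output is injective. *)
Lemma integral_decomp y : sw (fun x z => lam (S z * y) *: x) Lam = y.
Proof.
apply: (can_inj SK); rewrite -[RHS]dual_basisr -[in RHS]antipode_integral.
rewrite sw_antipode; last by lin_tac.
rewrite (sw_comp (h := S)); last by lin_tac.
by apply: eq_sw => u v; rewrite linearZ.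
Qed.

(** Expanding y by [integral_decomp] and S x by [dual_basisr] turns both sides into the sum of lam
    (L2' y) lam (L1 x), with L1, L2 the legs of [Lam] and L2' = S(L2). *)
Lemma cointegral_trace x y : lam (y * x) = lam (S (S x) * y).
Proof.
rewrite -{1}[y]integral_decomp -[S x]dual_basisr.
rewrite (sw_comp (h := fun t => lam (t * x) : k^o)); last by lin_tac.
rewrite (sw_comp (h := fun t => lam (S t * y) : k^o)); last by lin_tac.
apply: (@eq_sw _ _ k^o) => u v.
by rewrite -scalerAl !linearZ /= -scalerAl linearZ /= mulrC.
Qed.

End Cointegral.

(** * Partial traces of two-leg tensors and their centrality *)

Section Slices.
Variables (k : fieldType) (A : hopfAlgType k).
Local Notation Delta := (@comul k A).
Local Notation eps := (@counit k A).
Local Notation S := (@antipode k A).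
Implicit Types (W : lmodType k) (a b c x y : A) (p q : {scalar A}).
Implicit Types (s t : tensor A A).

Definition slicel p t : A := tmap (fun x y => p x *: y) t.
Definition slicer p t : A := tmap (fun x y => p y *: x) t.

Lemma tmap_mulltens W (f : A -> A -> W) a b t : bilin f ->
  tmap f ((a ⊗ b) * t) = tmap (fun x y => f (a * x) (b * y)) t.
Proof.
by move=> bf; case: (bf) => fl fr; rewrite tmapM // tmapE //; lin_tac.
Qed.

Lemma tmap_mulrtens W (f : A -> A -> W) a b t : bilin f ->
  tmap f (t * (a ⊗ b)) = tmap (fun x y => f (x * a) (y * b)) t.
Proof.
move=> bf; case: (bf) => fl fr; rewrite tmapM //; apply: eq_tmap => x y.
by rewrite tmapE //; lin_tac.
Qed.

Variable Si : {linear A -> A}.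
Hypotheses (SK : cancel S Si) (SiK : cancel Si S).

Lemma sw_Sil W (f : A -> W) a : lin f ->
  sw (fun x y => f (Si y * x)) a = eps a *: f 1.
Proof.
move=> lf; transitivity (eps a *: f (Si 1)); last first.
  by rewrite -{1}antipode1 SK.
rewrite -(sw_antipodel (f := fun x => f (Si x))); last by lin_tac.
by apply: eq_sw => x y; rewrite (SiM SK SiK) SK.
Qed.

Lemma sw_Sir W (f : A -> W) a : lin f ->
  sw (fun x y => f (y * Si x)) a = eps a *: f 1.
Proof.
move=> lf; transitivity (eps a *: f (Si 1)); last first.
  by rewrite -{1}antipode1 SK.
rewrite -(sw_antipoder (f := fun x => f (Si x))); last by lin_tac.
by apply: eq_sw => x y; rewrite (SiM SK SiK) SK.
Qed.

(** This and the next three identities write 1 (x) c or c (x) 1 through the coproduct, with the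
    correcting leg on the left or on the right. A tensor commuting with the image of [Delta] can
    then be moved past them inside a partial trace. *)
Lemma tens1l_Sl c : 1 ⊗ c = sw (fun x y => (S x ⊗ 1) * Delta y) c.
Proof.
transitivity (sw (fun x w => sw (fun u v => (S x * u) ⊗ v) w) c); last first.
  apply: eq_sw => x w; rewrite -[Delta w]sw_tens.
  rewrite (sw_comp (h := fun t => _ * t)); last by lin_tac.
  by apply: eq_sw => u v; rewrite tensM mul1r.
rewrite -(swA (f := fun x u v => (S x * u) ⊗ v)); last by split; lin_tac.
rewrite -[LHS](sw_counitl (f := fun c : A => 1 ⊗ c)); last by lin_tac.
by apply: eq_sw => x y; rewrite (sw_antipodel (f := fun t : A => t ⊗ y)) //; lin_tac.
Qed.

Lemma tens1l_Sir c : 1 ⊗ c = sw (fun x y => Delta y * (Si x ⊗ 1)) c.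
Proof.
transitivity (sw (fun x w => sw (fun u v => (u * Si x) ⊗ v) w) c); last first.
  apply: eq_sw => x w; rewrite -[Delta w]sw_tens.
  rewrite (sw_comp (h := fun t => t * _)); last by lin_tac.
  by apply: eq_sw => u v; rewrite tensM mulr1.
rewrite -(swA (f := fun x u v => (u * Si x) ⊗ v)); last by split; lin_tac.
rewrite -[LHS](sw_counitl (f := fun c : A => 1 ⊗ c)); last by lin_tac.
by apply: eq_sw => x y; rewrite (sw_Sir (f := fun t : A => t ⊗ y)) //; lin_tac.
Qed.

Lemma tens1r_Sil c : c ⊗ 1 = sw (fun x y => (1 ⊗ Si y) * Delta x) c.
Proof.
transitivity (sw (fun w y => sw (fun u v => u ⊗ (Si y * v)) w) c); last first.
  apply: eq_sw => w y; rewrite -[Delta w]sw_tens.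
  rewrite (sw_comp (h := fun t => _ * t)); last by lin_tac.
  by apply: eq_sw => u v; rewrite tensM mul1r.
rewrite (swA (f := fun u v y => u ⊗ (Si y * v))); last by split; lin_tac.
rewrite -[LHS](sw_counitr (f := fun c : A => c ⊗ 1)); last by lin_tac.
by apply: eq_sw => x y; rewrite (sw_Sil (f := fun t : A => x ⊗ t)) //; lin_tac.
Qed.

Lemma tens1r_Sr c : c ⊗ 1 = sw (fun x y => Delta x * (1 ⊗ S y)) c.
Proof.
transitivity (sw (fun w y => sw (fun u v => u ⊗ (v * S y)) w) c); last first.
  apply: eq_sw => w y; rewrite -[Delta w]sw_tens.
  rewrite (sw_comp (h := fun t => t * _)); last by lin_tac.
  by apply: eq_sw => u v; rewrite tensM mulr1.
rewrite (swA (f := fun u v y => u ⊗ (v * S y))); last by split; lin_tac.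
rewrite -[LHS](sw_counitr (f := fun c : A => c ⊗ 1)); last by lin_tac.
by apply: eq_sw => x y; rewrite (sw_antipoder (f := fun t : A => x ⊗ t)) //; lin_tac.
Qed.

(** Traces twisted by S^2, one for each leg: for a central, x |-> lam (a x) will satisfy [S2trace],
    and x |-> lam (S (a x)) the mirror condition [coS2trace]. *)
Definition S2trace p := forall x y, p (y * x) = p (S (S x) * y).
Definition coS2trace p := forall x y, p (x * y) = p (y * S (S x)).

(** Write 1 (x) c as Delta(c2) (Si(c1) (x) 1) on the right of t and move Delta(c2) past t. The
    twisted trace brings Si(c1) to the front as S(c1), which reassembles 1 (x) c on the left. *)
Lemma slicel_central p t : S2trace p -> (forall c, t * Delta c = Delta c * t) ->
  slicel p t \in center A.
Proof.
move=> pT tD; apply/centerP => c; have bp : bilin (fun x y : A => p x *: y) by lin_tac.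
transitivity (slicel p (t * (1 ⊗ c))).
  rewrite /slicel tmap_mulrtens // (lin_tmap_comp (h := fun z => z * c));
    last by lin_tac.
  by apply: eq_tmap => x y; rewrite mulr1 scalerAl.
transitivity (slicel p ((1 ⊗ c) * t)); last first.
  rewrite /slicel tmap_mulltens // (lin_tmap_comp (h := fun z => c * z));
    last by lin_tac.
  by apply: eq_tmap => x y; rewrite mul1r scalerAr.
rewrite {1}tens1l_Sir tens1l_Sl.
rewrite (sw_comp (h := fun s => slicel p (t * s))); last by rewrite /slicel; lin_tac.
rewrite (sw_comp (h := fun s => slicel p (s * t))); last by rewrite /slicel; lin_tac.
apply: eq_sw => x y.
rewrite /slicel mulrA -[_ * Delta y * t]mulrA -tD tmap_mulrtens // tmap_mulltens //.
by apply: eq_tmap => u v; rewrite mulr1 mul1r pT SiK.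
Qed.

Lemma slicer_central p t : coS2trace p -> (forall c, t * Delta c = Delta c * t) ->
  slicer p t \in center A.
Proof.
move=> pT tD; apply/centerP => c; have bp : bilin (fun x y : A => p y *: x) by lin_tac.
transitivity (slicer p (t * (c ⊗ 1))).
  rewrite /slicer tmap_mulrtens // (lin_tmap_comp (h := fun z => z * c));
    last by lin_tac.
  by apply: eq_tmap => x y; rewrite mulr1 scalerAl.
transitivity (slicer p ((c ⊗ 1) * t)); last first.
  rewrite /slicer tmap_mulltens // (lin_tmap_comp (h := fun z => c * z));
    last by lin_tac.
  by apply: eq_tmap => x y; rewrite mul1r scalerAr.
rewrite {1}tens1r_Sr tens1r_Sil.
rewrite (sw_comp (h := fun s => slicer p (t * s))); last by rewrite /slicer; lin_tac.
rewrite (sw_comp (h := fun s => slicer p (s * t))); last by rewrite /slicer; lin_tac.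
apply: eq_sw => x y.
rewrite /slicer mulrA -[_ * Delta x * t]mulrA -tD tmap_mulrtens // tmap_mulltens //.
by apply: eq_tmap => u v; rewrite mulr1 mul1r [in RHS]pT SiK.
Qed.

End Slices.

(** * The hexagon axioms, antipode invariance of R, and the monodromy R21 R *)

Section RMatrix.
Variables (k : fieldType) (A : hopfAlgType k) (R : tensor A A).
Local Notation Delta := (@comul k A).
Local Notation eps := (@counit k A).
Local Notation S := (@antipode k A).
Implicit Types (W : lmodType k) (a b c x y : A) (p q : {scalar A}).
Hypothesis RP : quasitriangular R.

Lemma Rmatrix_comull W (f : A -> A -> A -> W) : trilin f ->
  tmap (fun x z => sw (fun x1 x2 => f x1 x2 z) x) R =
  tmap (fun x y => tmap (fun x' y' => f x x' (y * y')) R) R.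
Proof.
case=> f1 f2 f3; case: RP => _ _ RD _.
pose G (t : tensor A A) (z : A) := tmap (fun x y => f x y z) t.
have bG : bilin G by rewrite /G; lin_tac.
transitivity (tmap G (tmap2 Delta idfun R)).
  by rewrite /tmap2 tmap_tmap; apply: eq_tmap => x z; rewrite tmapE.
rewrite RD /leg13 (lin_tmap_comp (h := fun t => t * leg23 R)); last by lin_tac.
rewrite tmap_tmap; apply: eq_tmap => x y.
rewrite /leg23 (lin_tmap_comp (h := fun t => _ * t)); last by lin_tac.
rewrite tmap_tmap; apply: eq_tmap => x' y'.
by rewrite tensM tensM mulr1 mul1r tmapE // /G tmapE //; lin_tac.
Qed.

Lemma Rmatrix_comulr W (f : A -> A -> A -> W) : trilin f ->
  tmap (fun x y => sw (fun y1 y2 => f x y1 y2) y) R =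
  tmap (fun x y => tmap (fun x' y' => f (x * x') y' y) R) R.
Proof.
case=> f1 f2 f3; case: RP => _ _ _ RD.
pose G (t : tensor A A) (z : A) := tmap (fun x y => f x y z) t.
have bG : bilin G by rewrite /G; lin_tac.
transitivity (tmap G (tassoc (tmap2 idfun Delta R))).
  rewrite /tmap2 /tassoc !tmap_tmap; apply: eq_tmap => x y.
  rewrite tmapE; last by lin_tac.
  rewrite tmap_tmap; apply: eq_tmap => u v; rewrite tmapE // /G tmapE //.
  by lin_tac.
rewrite RD /leg13 (lin_tmap_comp (h := fun t => t * leg12 R)); last by lin_tac.
rewrite tmap_tmap; apply: eq_tmap => x y.
rewrite /leg12 (lin_tmap_comp (h := fun t => _ * t)); last by lin_tac.
rewrite tmap_tmap; apply: eq_tmap => x' y'.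
by rewrite tensM tensM mulr1 mul1r tmapE // /G tmapE //; lin_tac.
Qed.

Lemma Rmatrix_unit : R \is a GRing.unit. Proof. by case: RP. Qed.

(** Applying the counit to the first leg of the hexagon axiom gives (1 (x) r) R = R, and R is
    invertible. *)
Lemma Rmatrix_counitl : tmap (fun x y => eps x *: y) R = 1.
Proof.
set r := LHS.
have e : (1 ⊗ r) * R = R.
  transitivity (tmap (fun x z => sw (fun x1 x2 => eps x1 *: (x2 ⊗ z)) x) R); last first.
    rewrite -[RHS]tmap_tens; apply: eq_tmap => x z.
    by rewrite (sw_counitl (f := fun x : A => x ⊗ z)) //; lin_tac.
  rewrite Rmatrix_comull; last by split; lin_tac.
  rewrite /r (lin_tmap_comp (h := fun t => (1 ⊗ t) * R)); last by lin_tac.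
  apply: eq_tmap => x y; rewrite -{1}[R]tmap_tens.
  rewrite (lin_tmap_comp (h := fun t => _ * t)); last by lin_tac.
  by apply: eq_tmap => x' y'; rewrite tensM mul1r -scalerAl tensZr.
have {}e : (1 : A) ⊗ r = (1 : A) ⊗ (1 : A).
  have inj := mulIr Rmatrix_unit; apply: inj.
  exact: etrans e (esym (mul1r R)).
have := congr1 (tmap (fun x y : A => eps x *: y)) e.
by rewrite !tmapE ?rmorph1 ?scale1r //; lin_tac.
Qed.

Lemma Rmatrix_counitr : tmap (fun x y => eps y *: x) R = 1.
Proof.
set r := LHS.
have e : (r ⊗ 1) * R = R.
  transitivity (tmap (fun x z => sw (fun x1 x2 => eps x2 *: (x ⊗ x1)) z) R); last first.
    rewrite -[RHS]tmap_tens; apply: eq_tmap => x z.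
    by rewrite (sw_counitr (f := fun z : A => x ⊗ z)) //; lin_tac.
  rewrite (Rmatrix_comulr (f := fun x x1 x2 => eps x2 *: (x ⊗ x1)));
    last by split; lin_tac.
  rewrite /r (lin_tmap_comp (h := fun t => (t ⊗ 1) * R)); last by lin_tac.
  apply: eq_tmap => x y; rewrite -{1}[R]tmap_tens.
  rewrite (lin_tmap_comp (h := fun t => _ * t)); last by lin_tac.
  by apply: eq_tmap => x' y'; rewrite tensM mul1r -scalerAl tensZl.
have {}e : r ⊗ (1 : A) = (1 : A) ⊗ (1 : A).
  have inj := mulIr Rmatrix_unit; apply: inj.
  exact: etrans e (esym (mul1r R)).
have := congr1 (tmap (fun x y : A => eps y *: x)) e.
by rewrite !tmapE ?rmorph1 ?scale1r //; lin_tac.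
Qed.

Variable Si : {linear A -> A}.
Hypotheses (SK : cancel S Si) (SiK : cancel Si S).

(** Both (S (x) 1) R and (1 (x) Si) R are left inverses of R, hence equal; S is then applied to the
    second leg. *)
Lemma Rmatrix_SS W (f : A -> A -> W) : bilin f ->
  tmap (fun x y => f (S x) (S y)) R = tmap f R.
Proof.
move=> bf.
have e1 : tmap (fun x y => S x ⊗ y) R * R = 1.
  transitivity (tmap (fun x z => sw (fun x1 x2 => (S x1 * x2) ⊗ z) x) R).
    rewrite (Rmatrix_comull (f := fun x1 x2 z => (S x1 * x2) ⊗ z));
      last by split; lin_tac.
    rewrite (lin_tmap_comp (h := fun t => t * R)); last by lin_tac.
    apply: eq_tmap => x y; rewrite -{1}[R]tmap_tens.
    rewrite (lin_tmap_comp (h := fun t => _ * t)); last by lin_tac.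
    by apply: eq_tmap => x' y'; rewrite tensM.
  rewrite -[RHS]/(1 ⊗ 1) -[X in _ = _ ⊗ X]Rmatrix_counitl (lin_tmap_comp (h := fun t => 1 ⊗ t));
    last by lin_tac.
  apply: eq_tmap => x y; rewrite (sw_antipodel (f := fun t : A => t ⊗ y)) ?tensZr //.
  by lin_tac.
have e2 : tmap (fun x y => x ⊗ Si y) R * R = 1.
  transitivity (tmap (fun x z => sw (fun x1 x2 => x ⊗ (Si x2 * x1)) z) R).
    rewrite (Rmatrix_comulr (f := fun x x1 x2 => x ⊗ (Si x2 * x1)));
      last by split; lin_tac.
    rewrite (lin_tmap_comp (h := fun t => t * R)); last by lin_tac.
    apply: eq_tmap => x y; rewrite -{1}[R]tmap_tens.
    rewrite (lin_tmap_comp (h := fun t => _ * t)); last by lin_tac.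
    by apply: eq_tmap => x' y'; rewrite tensM.
  rewrite -[RHS]/(1 ⊗ 1) -[X in _ = X ⊗ _]Rmatrix_counitr (lin_tmap_comp (h := fun t => t ⊗ 1));
    last by lin_tac.
  apply: eq_tmap => x y; rewrite (sw_Sil SK SiK (f := fun t : A => x ⊗ t)) ?tensZl //.
  by lin_tac.
have {e1 e2}e : tmap (fun x y => S x ⊗ y) R = tmap (fun x y => x ⊗ Si y) R.
  by apply: (mulIr Rmatrix_unit); rewrite e1 e2.
have bf' : bilin (fun x y => f x (S y)) by lin_tac.
have := congr1 (tmap (fun x y => f x (S y))) e; rewrite !tmap_tmap => h.
transitivity (tmap (fun u v => tmap (fun x y => f x (S y)) (S u ⊗ v)) R).
  by apply: eq_tmap => u v; rewrite tmapE.
by rewrite h; apply: eq_tmap => u v; rewrite tmapE ?SiK.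
Qed.

Lemma Rmatrix_comulC c : R * Delta c = tflip (Delta c) * R.
Proof. by case: RP => Ru RD _ _; rewrite RD; exact: esym (divrK Ru _). Qed.

Definition monodromy : tensor A A := tflip R * R.

Lemma tflipM (s t : tensor A A) : tflip (s * t) = tflip s * tflip t.
Proof.
rewrite {1}/tflip tmapM; last by lin_tac.
rewrite /tflip (lin_tmap_comp (h := fun t => t * _)); last by lin_tac.
apply: eq_tmap => x y.
rewrite (lin_tmap_comp (h := fun t => _ * t)); last by lin_tac.
by apply: eq_tmap => x' y'; rewrite tensM.
Qed.

Lemma tflipK (t : tensor A A) : tflip (tflip t) = t.
Proof.
rewrite {1}/tflip tmap_flip; last by lin_tac.
exact: tmap_tens.
Qed.

Lemma monodromy_comul c : monodromy * Delta c = Delta c * monodromy.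
Proof.
by rewrite /monodromy -mulrA Rmatrix_comulC !mulrA -tflipM Rmatrix_comulC tflipM tflipK.
Qed.

Lemma tmap_monodromy W (f : A -> A -> W) : bilin f ->
  tmap f monodromy =
  tmap (fun x y => tmap (fun x' y' => f (y * x') (x * y')) R) R.
Proof.
move=> bf; case: (bf) => f1 f2.
by rewrite /monodromy tmapM // tmap_flip //; lin_tac.
Qed.

End RMatrix.

Section MulForms.
Variables (k : fieldType) (A : hopfAlgType k) (lam : {scalar A}).

Definition mulform (a x : A) : k := lam (a * x).
Fact mulform_linear a : scalar (mulform a).
Proof. by move=> c x y; rewrite /mulform mulrDr -scalerAr linearP. Qed.
HB.instance Definition _ a :=
  GRing.isLinear.Build k A k _ (mulform a) (mulform_linear a).

Definition antipodeform (a x : A) : k := lam (antipode (a * x)).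
Fact antipodeform_linear a : scalar (antipodeform a).
Proof. by move=> c x y; rewrite /antipodeform mulrDr -scalerAr !linearP. Qed.
HB.instance Definition _ a :=
  GRing.isLinear.Build k A k _ (antipodeform a) (antipodeform_linear a).

End MulForms.

(** * The Drinfeld map, sending p to (p (x) 1) (R21 R), on twisted traces *)

Section DrinfeldMap.
Variables (k : fieldType) (A : hopfAlgType k) (R : tensor A A).
Local Notation Delta := (@comul k A).
Local Notation eps := (@counit k A).
Local Notation S := (@antipode k A).
Implicit Types (W : lmodType k) (a b c x y : A) (p q : {scalar A}).
Hypothesis RP : quasitriangular R.
Local Notation Q := (monodromy R).

Lemma slicel_monodromy p :
  slicel p Q = tmap (fun x y => tmap (fun x' y' => p (y * x') *: (x * y')) R) R.
Proof. by rewrite /slicel tmap_monodromy //; lin_tac. Qed.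

(** After both hexagon expansions, the two copies of R seen by p are nested between the two seen by
    q. The inner pair sums to [slicel p Q], which centrality pulls out of the product. *)
Lemma slicel_monodromyM p q : slicel p Q \in center A ->
  tmap (fun u v => sw (fun u1 u2 => (p u1 * q u2) *: v) u) Q =
  slicel p Q * slicel q Q.
Proof.
move=> /centerP pZ.
transitivity (tmap (fun x y => sw (fun y1 y2 => tmap (fun x' y' =>
   sw (fun x1 x2 => (p (y1 * x1) * q (y2 * x2)) *: (x * y')) x') R) y) R).
  rewrite tmap_monodromy; last by lin_tac.
  apply: eq_tmap => x y; rewrite /sw tmap_swap; apply: eq_tmap => x' y'.
  by rewrite -/(sw _ (y * x')) swM //; lin_tac.
rewrite (Rmatrix_comulr RP (f := fun x y1 y2 => tmap (fun x' y' =>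
   sw (fun x1 x2 => (p (y1 * x1) * q (y2 * x2)) *: (x * y')) x') R));
     last by split; lin_tac.
transitivity (tmap (fun x y => tmap (fun a b => tmap (fun x' y' =>
  tmap (fun a' b' => (p (b * x') * q (y * a')) *: (x * a * (y' * b'))) R) R) R) R).
  apply: eq_tmap => x y; apply: eq_tmap => a b.
  by rewrite (Rmatrix_comull RP (f := fun x1 x2 y' =>
    (p (b * x1) * q (y * x2)) *: (x * a * y'))) //; split; lin_tac.
rewrite [slicel q Q]slicel_monodromy (lin_tmap_comp (h := fun t => _ * t));
  last by lin_tac.
apply: eq_tmap => x y.
rewrite (lin_tmap_comp (h := fun t => _ * t)); last by lin_tac.
transitivity (tmap (fun a' b' => q (y * a') *: (x * slicel p Q * b')) R); last first.
  by apply: eq_tmap => a' b'; rewrite -scalerAr mulrA pZ.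
transitivity (tmap (fun a' b' => tmap (fun a b => tmap (fun x' y' =>
   (p (b * x') * q (y * a')) *: (x * a * (y' * b'))) R) R) R).
  by rewrite [RHS]tmap_swap; apply: eq_tmap => a b; rewrite tmap_swap.
apply: eq_tmap => a' b'.
rewrite slicel_monodromy (lin_tmap_comp (h := fun t => _ *: (x * t * b')));
  last by lin_tac.
apply: eq_tmap => a b.
rewrite (lin_tmap_comp (h := fun t => _ *: (x * t * b'))); last by lin_tac.
apply: eq_tmap => x' y'.
by rewrite -scalerAr -scalerAl scalerA mulrC !mulrA.
Qed.

Variable Si : {linear A -> A}.
Hypotheses (SK : cancel S Si) (SiK : cancel Si S).

(** Put S^2 on both legs of one copy of R. On the leg under p, the twisted trace trades this S^2 for
    a cyclic rotation; on the other leg it stays. *)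
Lemma slicel_monodromy_trace p : S2trace p ->
  slicel p Q = tmap (fun x y => tmap (fun x' y' =>
     p (x * y') *: (S (S x') * y)) R) R.
Proof.
move=> pT; rewrite slicel_monodromy tmap_swap; apply: eq_tmap => x y.
have SS := Rmatrix_SS RP SK SiK.
transitivity (tmap (fun x' y' => p (S (S y') * x) *: (S (S x') * y)) R).
  rewrite (SS _ (fun x' y' => p (S y' * x) *: (S x' * y))); last by lin_tac.
  by rewrite (SS _ (fun x' y' => p (y' * x) *: (x' * y))) //; lin_tac.
by apply: eq_tmap => x' y'; rewrite -pT.
Qed.

Lemma slicel_monodromyC p q : S2trace p -> S2trace q ->
  q (slicel p Q) = p (slicel q Q).
Proof.
move=> pT qT; rewrite slicel_monodromy_trace // slicel_monodromy.
rewrite (lin_tmap_comp (h := (q : A -> k^o))); last by lin_tac.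
rewrite (lin_tmap_comp (h := (p : A -> k^o))); last by lin_tac.
apply: (@eq_tmap _ _ _ k^o) => x y.
rewrite (lin_tmap_comp (h := (q : A -> k^o))); last by lin_tac.
rewrite (lin_tmap_comp (h := (p : A -> k^o))); last by lin_tac.
apply: (@eq_tmap _ _ _ k^o) => x' y'.
by rewrite !linearZ /= -qT mulrC.
Qed.

(** Under p (x) q a factor R moves cyclically past any tensor, since S^2 (x) S^2 fixes R.
    Conjugating Delta(x) by R, which flips it, is therefore invisible. *)
Lemma S2trace_convC p q x : S2trace p -> S2trace q ->
  sw (fun u v => p u * q v : k^o) x = sw (fun u v => q u * p v : k^o) x.
Proof.
move=> pT qT.
have bpq : bilin (fun u v => p u * q v : k^o) by lin_tac.
have SS := Rmatrix_SS RP SK SiK.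
have trR (t : tensor A A) : tmap (fun u v => p u * q v : k^o) (t * R) =
             tmap (fun u v => p u * q v : k^o) (R * t).
  rewrite !tmapM // [RHS]tmap_swap; apply: eq_tmap => u v.
  transitivity (tmap (fun x y => p (S (S x) * u) * q (S (S y) * v) : k^o) R).
    apply: (@eq_tmap _ _ _ k^o) => x' y'; exact: (congr2 *%R (pT _ _) (qT _ _)).
  rewrite (SS _ (fun x y => p (S x * u) * q (S y * v) : k^o)); last by lin_tac.
  by rewrite (SS _ (fun x y => p (x * u) * q (y * v) : k^o)) //; lin_tac.
have [Ru RD _ _] := RP.
transitivity (tmap (fun u v => p u * q v : k^o) (tflip (Delta x))); last first.
  by rewrite tmap_flip //; apply: eq_tmap => u v; rewrite mulrC.
by rewrite RD -mulrA -trR divrK.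
Qed.

End DrinfeldMap.

(** * The map J and the product star on the center *)

Section JMap.
Variables (k : fieldType) (A : hopfAlgType k) (R : tensor A A) (lam : {scalar A}).
Local Notation Delta := (@comul k A).
Local Notation eps := (@counit k A).
Local Notation S := (@antipode k A).
Implicit Types (W : lmodType k) (a b c x y : A) (p q : {scalar A}).
Local Notation Q := (monodromy R).
Local Notation Z := (center A).
Local Notation J := (Jmap lam R).
Local Notation star := (star lam).
Hypotheses (RP : quasitriangular R) (lamP : right_cointegral lam).
Variables (Si : {linear A -> A}) (Lam : A).
Hypotheses (SK : cancel S Si) (SiK : cancel Si S).
Hypotheses (LamP : integral Lam) (lamLam : lam Lam = 1).

Lemma Jmap_slicel a : J a = slicel (mulform lam a) Q.
Proof.
rewrite /Jmap -/(monodromy R) tmap_mulltens; last by lin_tac.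
by apply: eq_tmap => x y; rewrite mul1r.
Qed.

Lemma centerM a b : a \in Z -> b \in Z -> a * b \in Z.
Proof.
move=> /centerP aZ /centerP bZ; apply/centerP => x.
by rewrite -mulrA bZ mulrA aZ mulrA.
Qed.

Lemma antipode_center a : a \in Z -> S a \in Z.
Proof.
by move/centerP=> aZ; apply/centerP => b; rewrite -[b]SiK -!antipodeM aZ.
Qed.

Lemma cointegral_S2trace : S2trace lam.
Proof. move=> x y; exact: (cointegral_trace lamP SK SiK LamP lamLam). Qed.

Lemma mulform_S2trace a : a \in Z -> S2trace (mulform lam a).
Proof.
move=> /centerP aZ x y; rewrite /= /mulform mulrA cointegral_S2trace.
by rewrite mulrA -aZ mulrA.
Qed.

Lemma antipodeform_coS2trace a : a \in Z -> coS2trace (antipodeform lam a).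
Proof.
move=> /centerP aZ x y; rewrite /= /antipodeform aZ -mulrA antipodeM.
by rewrite cointegral_S2trace -antipodeM -aZ mulrA.
Qed.

Lemma Jmap_center a : a \in Z -> J a \in Z.
Proof.
move=> aZ; rewrite Jmap_slicel; apply: (slicel_central SK SiK).
  exact: mulform_S2trace.
exact: monodromy_comul.
Qed.

Lemma comul_slice_center a b : a \in Z -> b \in Z ->
  sw (fun x y => lam (a * x) *: y) b \in Z.
Proof.
move=> aZ /centerP bZ; apply: (slicel_central SK SiK (p := mulform lam a)).
  exact: mulform_S2trace.
by move=> c; rewrite -!rmorphM bZ.
Qed.

Lemma star_center a b : a \in Z -> b \in Z -> star a b \in Z.
Proof. by move=> /antipode_center aZ bZ; apply: comul_slice_center. Qed.

(** Both sides equal the sum of lam (S(a2) b) lam (a1 x), obtained by moving the coproducts of b and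
    of x onto a. *)
Lemma cointegral_starr a b x :
  lam (star a b * x) = lam (b * sw (fun u v => lam (a * u) *: v) x).
Proof.
transitivity (sw (fun u v => lam (S v * b) * lam (u * x) : k^o) a).
  rewrite /Defs.star -/(sw _ b) (cointegral_moveSi lamP SK) sw_antipode;
    last by lin_tac.
  rewrite (sw_comp (h := fun t => lam (t * x) : k^o)); last by lin_tac.
  apply: (@eq_sw _ _ k^o) => u v.
  by rewrite SK -scalerAl linearZ.
rewrite (cointegral_moveSi lamP SK).
rewrite (sw_comp (h := fun t => lam (b * t) : k^o)); last by lin_tac.
apply: (@eq_sw _ _ k^o) => u v.
by rewrite -scalerAr linearZ /= (cointegral_S2trace (Si v) b) SiK mulrC.
Qed.

Lemma cointegral_star a b x : lam (star a b * x) =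
  sw (fun u v => lam (a * u) * lam (b * v) : k^o) x.
Proof.
rewrite cointegral_starr (sw_comp (h := fun t => lam (b * t) : k^o)); last by lin_tac.
by apply: (@eq_sw _ _ k^o) => u v; rewrite -scalerAr linearZ.
Qed.

Lemma starC a b : a \in Z -> b \in Z -> star a b = star b a.
Proof.
move=> aZ bZ; apply: (cointegral_inj lamP SK SiK LamP lamLam) => x.
rewrite !cointegral_star.
exact: (S2trace_convC RP SK SiK x (mulform_S2trace aZ) (mulform_S2trace bZ)).
Qed.

Lemma Jmap_star a b : a \in Z -> J (star a b) = J a * J b.
Proof.
move=> /Jmap_center; rewrite !Jmap_slicel => JaZ.
rewrite -slicel_monodromyM //; apply: eq_tmap => u v.
rewrite /= /mulform cointegral_star.
by rewrite (sw_comp (h := fun s : k^o => s *: v)) //; lin_tac.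
Qed.

(** lam (Lam x) is the counit of x, and R has trivial counit on either leg. *)
Lemma Jmap_integral : J Lam = 1.
Proof.
rewrite Jmap_slicel slicel_monodromy -[RHS](Rmatrix_counitr RP).
apply: eq_tmap => x y; transitivity (eps y *: (x * tmap (fun x' y' => eps x' *: y') R)).
  rewrite (lin_tmap_comp (h := fun t => eps y *: (x * t))); last by lin_tac.
  apply: eq_tmap => x' y'; rewrite /= /mulform LamP.2 linearZ /= lamLam mulr1.
  by rewrite rmorphM -scalerAr scalerA.
by rewrite Rmatrix_counitl // mulr1.
Qed.

Lemma cointegral_JmapC a b : a \in Z -> b \in Z -> lam (b * J a) = lam (a * J b).
Proof.
move=> aZ bZ; rewrite !Jmap_slicel.
exact: (slicel_monodromyC RP SK SiK (mulform_S2trace aZ) (mulform_S2trace bZ)).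
Qed.

Lemma Jmap_Jmap a : a \in Z -> J (J a) = star (S a) (J 1).
Proof.
move=> aZ; pose p : {scalar A} := mulform lam a.
have pT : S2trace p by apply: mulform_S2trace.
(* star (S a) (J 1) is the slice of Delta(J(1)) by lam_a: the twisted trace and centrality turn lam
   (S^2(a) u) into lam (a u). *)
transitivity (sw (fun u v => p u *: v) (J 1)); last first.
  apply: eq_sw => u v; rewrite -cointegral_S2trace /p /= /mulform.
  by move/centerP: aZ => ->.
rewrite [in RHS]Jmap_slicel slicel_monodromy.
transitivity (tmap (fun x y => sw (fun x1 x2 => tmap (fun x' y' => sw (fun y1 y2 =>
    lam (y * x') *: (p (x1 * y1) *: (x2 * y2))) y') R) x) R); last first.
  rewrite (lin_tmap_comp (h := sw (fun u v => p u *: v))); last by lin_tac.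
  apply: eq_tmap => x y.
  rewrite (lin_tmap_comp (h := sw (fun u v => p u *: v))); last by lin_tac.
  rewrite {1}/sw tmap_swap; apply: eq_tmap => x' y'; rewrite -/(sw _ x).
  rewrite (linZ (f := sw (fun u v => p u *: v))); last by lin_tac.
  rewrite swM; last by lin_tac.
  rewrite /= /mulform mul1r (sw_comp (h := fun t => _ *: t)); last by lin_tac.
  apply: eq_sw => x1 x2.
  by rewrite (sw_comp (h := fun t => _ *: t)) //; lin_tac.
rewrite (Rmatrix_comull RP (f := fun x1 x2 y => tmap (fun x' y' => sw (fun y1 y2 =>
    lam (y * x') *: (p (x1 * y1) *: (x2 * y2))) y') R)); last by split; lin_tac.
transitivity (tmap (fun x y => tmap (fun s t => tmap (fun x' y' => tmap (fun a' b' =>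
   lam (y * t * (x' * a')) *: (p (x * b') *: (s * y'))) R) R) R) R); last first.
  apply: eq_tmap => x y; apply: eq_tmap => s t.
  by rewrite (Rmatrix_comulr RP (f := fun x' y1 y2 =>
    lam (y * t * x') *: (p (x * y1) *: (s * y2)))) //; split; lin_tac.
rewrite [LHS]Jmap_slicel [LHS]slicel_monodromy [RHS]tmap_swap.
apply: eq_tmap => s t; rewrite [RHS]tmap_swap; apply: eq_tmap => x' y'.
rewrite /= /mulform Jmap_slicel (slicel_monodromy_trace RP SK SiK pT).
rewrite (lin_tmap_comp (h := fun z => lam (z * (t * x')) *: (s * y'))); last by lin_tac.
apply: eq_tmap => x y.
rewrite (lin_tmap_comp (h := fun z => lam (z * (t * x')) *: (s * y'))); last by lin_tac.
apply: eq_tmap => a' b'.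
(* Carrying a' around [lam] makes it S^2(a') in front of y. The copies (x, y) and (a', b') then
   contribute p (x b') S^2(a') y, which is J(a) as given by [slicel_monodromy_trace]. *)
have -> : lam (y * t * (x' * a')) = lam (S (S a') * y * (t * x')).
  by rewrite -[RHS]/(lam (_ * _ * _)) -[in RHS]mulrA -cointegral_S2trace !mulrA.
by rewrite -scalerAl linearZ /= !scalerA mulrC.
Qed.

Lemma counit_star a b : eps (star a b) = lam (S a * b).
Proof.
rewrite -[b in RHS](sw_counitr (f := fun x => x)) //.
rewrite (sw_comp (h := fun t => lam (S a * t) : k^o)); last by lin_tac.
rewrite /Defs.star -/(sw _ b) (sw_comp (h := (eps : A -> k^o))); last by lin_tac.
by apply: (@eq_sw _ _ k^o) => u v; rewrite -scalerAr !linearZ /= mulrC.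
Qed.

(** The counit of a star 1 is lam (S a) and that of 1 star a is lam a; the two products agree by
    [starC]. *)
Lemma cointegral_antipode a : a \in Z -> lam (S a) = lam a.
Proof.
move=> aZ; have oZ : (1 : A) \in Z by apply/centerP => b; rewrite mul1r mulr1.
have := counit_star a 1; rewrite starC // counit_star.
by rewrite antipode1 mulr1 mul1r => ->.
Qed.

Lemma antipode2_center a : a \in Z -> S (S a) = a.
Proof.
move=> aZ; apply: (cointegral_inj lamP SK SiK LamP lamLam) => x.
by rewrite -cointegral_S2trace; move/centerP: aZ => ->.
Qed.

Lemma cointegral_Jmap_antipode a b : a \in Z -> b \in Z ->
  lam (S a * J (S b)) = lam (J a * b).
Proof.
move=> aZ bZ.
have SS := Rmatrix_SS RP SK SiK.
pose pa : {scalar A} := antipodeform lam a; pose pb : {scalar A} := antipodeform lam b.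
have zZ : slicer pb Q \in Z.
  apply: (slicer_central SK SiK); last exact: monodromy_comul.
  exact: antipodeform_coS2trace.
transitivity (tmap (fun u v => pa u * pb v : k^o) Q).
  transitivity (tmap (fun x y => tmap (fun x' y' =>
      lam (S b * (y * x')) * lam (S a * (x * y')) : k^o) R) R).
    rewrite Jmap_slicel slicel_monodromy.
    rewrite (lin_tmap_comp (h := fun t => lam (S a * t) : k^o)); last by lin_tac.
    apply: (@eq_tmap _ _ _ k^o) => x y.
    rewrite (lin_tmap_comp (h := fun t => lam (S a * t) : k^o)); last by lin_tac.
    apply: (@eq_tmap _ _ _ k^o) => x' y'.
    by rewrite -scalerAr linearZ.
  rewrite tmap_monodromy; last by lin_tac.
  (* S (x) S is inserted in each copy of R; anti-multiplicativity reverses the products, which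
     exchanges the two copies. *)
  rewrite -(SS _ (fun x y => tmap (fun x' y' =>
      lam (S b * (y * x')) * lam (S a * (x * y')) : k^o) R)); last by lin_tac.
  rewrite [RHS]tmap_swap; apply: (@eq_tmap _ _ _ k^o) => x y.
  rewrite -(SS _ (fun x' y' => lam (S b * (S y * x')) * lam (S a * (S x * y')) : k^o));
    last by lin_tac.
  apply: (@eq_tmap _ _ _ k^o) => x' y'; rewrite /= /antipodeform mulrC.
  rewrite -[S y * S x']antipodeM -[S x * S y']antipodeM -!antipodeM.
  by move/centerP: (aZ) => ->; move/centerP: (bZ) => ->.
have pZ c d : c \in Z -> d \in Z -> lam (S (c * d)) = lam (c * d).
  by move=> cZ dZ; rewrite cointegral_antipode // centerM.
transitivity (pa (slicer pb Q)).
  rewrite /slicer (lin_tmap_comp (h := (pa : A -> k^o))); last by lin_tac.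
  by apply: (@eq_tmap _ _ _ k^o) => u v; rewrite linearZ /= mulrC.
transitivity (pb (J a)); last first.
  by rewrite /= /antipodeform pZ ?Jmap_center //; move/centerP: bZ => ->.
have -> : pa (slicer pb Q) = mulform lam a (slicer pb Q) by apply: pZ.
rewrite Jmap_slicel /slicer /slicel.
rewrite (lin_tmap_comp (h := (mulform lam a : A -> k^o))); last by lin_tac.
rewrite (lin_tmap_comp (h := (pb : A -> k^o))); last by lin_tac.
by apply: (@eq_tmap _ _ _ k^o) => u v; rewrite !linearZ /= mulrC.
Qed.

End JMap.

(** S^2 is conjugation by g, hence bijective, so S is too; its inverse is S after the inverse of
    S^2. *)
Lemma ribbon_antipode_bij (k : fieldType) (A : hopfAlgType k) (R : tensor A A) (g : A) :
  ribbon R g -> exists Si : {linear A -> A},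
    cancel (@antipode k A) Si /\ cancel Si (@antipode k A).
Proof.
case=> _ [gu _] S2.
pose f (a : A) := antipode (g^-1 * a * g).
have fL : linear f.
  by move=> c x y; rewrite /f mulrDr mulrDl -scalerAr -scalerAl linearP.
pose Si : {linear A -> A} := HB.pack f (GRing.isLinear.Build k A A _ f fL).
have SiK : cancel Si (@antipode k A).
  by move=> a; rewrite /= /f S2 !mulrA divrr // mul1r mulrK.
have Sinj : injective (@antipode k A).
  move=> x y /(congr1 (@antipode k A)); rewrite !S2.
  by move=> /(divIr gu)/(mulrI gu).
by exists Si; split=> // a; apply: Sinj; rewrite SiK.
Qed.

(** * Classes of central elements modulo K(A) *)

Section CenterQuotient.
Variables (k : fieldType) (A : hopfAlgType k) (lam : {scalar A}).
Implicit Types (a b : A) (x y : Zhat lam).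
Local Notation Z := (center A).
Local Notation cl := (Zclass lam).

Lemma ZclassK x : cl (vsval (Zhat_repr x)) = x.
Proof. by rewrite /Zclass vsvalK Zhat_reprK. Qed.

Lemma Zclass_linear : linear cl.
Proof. by move=> c a b; rewrite /Zclass linearP Zhat_piD Zhat_piZ. Qed.

Lemma ZclassM a b : a \in Z -> b \in Z -> cl (a * b) = cl a * cl b.
Proof.
move=> aZ bZ; rewrite /Zclass -[RHS]Zhat_piM; congr (Zhat_pi _ _).
by apply/val_inj; rewrite /= !vsprojK // centerM.
Qed.

Lemma Zclass1 : cl 1 = 1.
Proof.
have oZ : (1 : A) \in Z by apply/centerP => b; rewrite mul1r mulr1.
(* The unit of the subalgebra type is [algid], which equals 1 because 1 is central. *)
have e : vsproj Z 1 = 1.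
  by apply/val_inj; rewrite /= vsprojK //; apply/esym/eqP; rewrite algid_eq1.
exact: (congr1 (@Zhat_pi k A lam) e).
Qed.

End CenterQuotient.

(** * Descent of star and J to the quotient by K(A), and assembly of the three claims *)

Theorem proposition2p8 (k : fieldType) (A : hopfAlgType k)
    (R : tensor A A) (g : A) (Lam : A) (lam : {scalar A}) :
  unimodular A ->
  ribbon R g ->
  integral Lam -> right_cointegral lam -> lam Lam = 1 ->
  let Z := center A in
  let J := Jmap lam R in
  [/\ (* J maps Z(A) to Z(A), and star is a product on Z(A) *)
      (forall a, a \in Z -> J a \in Z) /\
      (forall a b, a \in Z -> b \in Z -> star lam a b \in Z),
      (* (a) *)
      (forall a b, a \in Z -> b \in Z -> J (star lam a b) = J a * J b) /\
      J Lam = 1,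
      (* (b) *)
      (forall a, a \in Z -> J (J a) = star lam (antipode a) (J 1))
    & (* (c) *)
      (forall a b, a \in Z -> b \in Z ->
         Zclass lam (star lam a b) = Zhat_star (Zclass lam a) (Zclass lam b)) /\
      exists Jhat : {linear Zhat lam -> Zhat lam},
        [/\ forall a, a \in Z -> Jhat (Zclass lam a) = Zclass lam (J a),
            forall x y, Jhat (Zhat_star x y) = Jhat x * Jhat y,
            Jhat (Zclass lam Lam) = 1
          & forall x, ZhatS x -> ZhatS (Jhat x)]].
Proof.
move=> _ Rg LamP lamP lamLam Z J.
have [RP _ _] := Rg; have [Si [SK SiK]] := ribbon_antipode_bij Rg.
have JZ a : a \in Z -> J a \in Z.
  exact: (Jmap_center RP lamP SK SiK LamP lamLam).
have starZ a b : a \in Z -> b \in Z -> star lam a b \in Z.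
  exact: (star_center lamP SK SiK LamP lamLam).
have starC a b : a \in Z -> b \in Z -> star lam a b = star lam b a.
  exact: (starC RP lamP SK SiK LamP lamLam).
have Jstar a b : a \in Z -> b \in Z -> J (star lam a b) = J a * J b.
  by move=> aZ _; exact: (Jmap_star RP lamP SK SiK LamP lamLam).
have JC a b : a \in Z -> b \in Z -> lam (J a * b) = lam (a * J b).
  move=> aZ bZ; rewrite -(cointegral_JmapC RP lamP SK SiK LamP lamLam) //.
  by move/centerP: bZ => ->.
have LamZ : Lam \in Z by apply/centerP => b; rewrite LamP.1 LamP.2.
have SZ a : a \in Z -> antipode a \in Z by exact: (antipode_center SiK).
(* J is self-adjoint for the form defining K(A), hence preserves its radical. *)
have cJ a b : a \in Z -> b \in Z ->
    Zclass lam a = Zclass lam b -> Zclass lam (J a) = Zclass lam (J b).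
  move=> aZ bZ /ZclassP ab; apply/ZclassP; rewrite ?JZ // => c cZ.
  by rewrite mulrBl linearB /= !JC // -linearB -mulrBl ab ?JZ.
have cstarr a b b' : a \in Z -> b \in Z -> b' \in Z ->
    Zclass lam b = Zclass lam b' ->
    Zclass lam (star lam a b) = Zclass lam (star lam a b').
  move=> aZ bZ b'Z /ZclassP bb'; apply/ZclassP; rewrite ?starZ // => c cZ.
  rewrite mulrBl linearB /= !(cointegral_starr lamP SK SiK LamP lamLam).
  rewrite -linearB -mulrBl bb' //.
  exact: (comul_slice_center lamP SK SiK LamP lamLam).
pose r := @Zhat_repr k A lam; have rZ x : vsval (r x) \in Z by apply: subvsP.
have cstar a b : a \in Z -> b \in Z ->
    Zclass lam (star lam a b) = Zhat_star (Zclass lam a) (Zclass lam b).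
  move=> aZ bZ; rewrite /Zhat_star -/r.
  (* Representatives are changed in the second slot, then commutativity brings the first argument
     there. *)
  rewrite (@cstarr a b (vsval (r (Zclass lam b)))) ?ZclassK // starC //.
  rewrite (@cstarr _ a (vsval (r (Zclass lam a)))) ?ZclassK //.
  by rewrite starC.
pose jh x := Zclass lam (J (vsval (r x))).
have jhE a : a \in Z -> jh (Zclass lam a) = Zclass lam (J a).
  by move=> aZ; apply: cJ; rewrite ?ZclassK.
have jhL : linear jh.
  move=> c x y; rewrite -{1}[x]ZclassK -{1}[y]ZclassK -Zclass_linear jhE.
    by rewrite /J linearP Zclass_linear.
  by rewrite memvD ?memvZ ?rZ.
pose Jhat : {linear Zhat lam -> Zhat lam} :=
  HB.pack jh (GRing.isLinear.Build k _ _ _ jh jhL).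
split=> //.
- split=> //; exact: (Jmap_integral RP LamP lamLam).
- move=> a aZ; exact: (Jmap_Jmap RP lamP SK SiK LamP lamLam).
split=> //; exists Jhat; split=> //.
- move=> x y; rewrite -[x]ZclassK -[y]ZclassK -cstar ?rZ //= !jhE ?starZ ?rZ //.
  by rewrite Jstar ?rZ // ZclassM ?JZ ?rZ.
- rewrite /= jhE // /J (Jmap_integral RP LamP lamLam).
  exact: Zclass1.
move=> _ [a aZ [-> aS]]; exists (J a); first exact: JZ.
split; first exact: jhE.
have Slam a' := cointegral_antipode RP lamP SK SiK LamP lamLam (a := a').
have S2 a' := antipode2_center lamP SK SiK LamP lamLam (a := a').
move/(ZclassP lam (SZ _ aZ) aZ): aS => aS; apply/ZclassP; rewrite ?SZ ?JZ // => c cZ.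
(* With c = S(S c), [cointegral_Jmap_antipode] gives lam (S(a) J(c)) = lam (J(a) S(c)), which is lam
   (S(J(a)) c) since lam o S = lam on the center. So the defect of J(a) against c is that of a
   against J(c). *)
have -> : lam ((antipode (J a) - J a) * c) = lam ((antipode a - a) * J c).
  rewrite !mulrBl !linearB /= JC //; congr (_ - _).
  rewrite -[c in RHS]S2 // (cointegral_Jmap_antipode RP lamP SK SiK LamP lamLam) ?SZ //.
  rewrite -[LHS]Slam ?centerM ?SZ ?JZ // antipodeM S2 ?JZ //.
  by move/centerP: (JZ _ aZ) => ->.
by rewrite aS ?JZ.
Qed.
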